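(* Let $d,n$ be positive integers and let $A$ and $B$ be measurable sets of positive measure in $\mathbb{T}^d$. Let $A'=I\times\mathbb{T}^{d-1}$ and $B'=J\times\mathbb{T}^{d-1}$ be bands in $\mathbb{T}^d$ (oriented in the same direction), where $I$ and $J$ are closed intervals in $\mathbb{T}$, with $|A'|=|A|$ and $|B'|=|B|$. Let $b_1,\dots,b_n$ be chosen independently and uniformly at random from $B$, and let $b'_1,\dots,b'_n$ be chosen independently and uniformly at random from $B'$. Then $$\mathbb{E}\Big(\Big|\bigcup_{i=1}^n(A+b_i)\Big|\Big)\ \ge\ \mathbb{E}\Big(\Big|\bigcup_{i=1}^n(A'+b'_i)\Big|\Big).$$
   Context: $\mathbb{T}=\mathbb{R}/\mathbb{Z}$ is the circle, and $|\cdot|$ denotes Lebesgue (Haar probability) measure on $\mathbb{T}^d$. The whole circle $\mathbb{T}$ is allowed as a closed interval in $\mathbb{T}$. $A+b=\{a+b: a\in A\}$. *)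

(* Defs.v *)
From HB Require Import structures.
From mathcomp Require Import all_boot all_order all_algebra.
From mathcomp Require Import all_classical all_reals all_analysis.
Set Implicit Arguments.
Unset Strict Implicit.
Unset Printing Implicit Defensive.

Import Order.TTheory GRing.Theory Num.Theory.
Import numFieldNormedType.Exports.
Local Open Scope classical_set_scope.
Local Open Scope ring_scope.
Local Open Scope quotient_scope.

Definition integers (R : realType) : {pred R} := [pred x | x \is a Num.int].

Fact integers_zmod_closed (R : realType) : zmod_closed (@integers R).
Proof. by split=> [|x y]; [exact: rpred0 | exact: rpredB]. Qed.

HB.instance Definition _ (R : realType) :=
  GRing.isZmodClosed.Build R (@integers R) (@integers_zmod_closed R).

Definition circle (R : realType) : Type := Quotient.quot (@integers R).

HB.instance Definition _ (R : realType) := GRing.Zmodule.on (circle R).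
HB.instance Definition _ (R : realType) := EqQuotient.on (circle R).
HB.instance Definition _ (R : realType) := isPointed.Build (circle R) 0.

Definition to_circle (R : realType) : R -> circle R := \pi_(circle R).

Section circle_borel.
Context {R : realType}.

(* The final sigma-algebra along the projection R -> R/Z; it consists of the
   Borel sets of R/Z. *)
Let borel : set (set (circle R)) :=
  image_set_system setT (@to_circle R) measurable.

Let borelS : sigma_algebra setT borel.
Proof. exact/sigma_algebra_image/sigma_algebra_measurable. Qed.

Let borel0 : borel set0. Proof. by case: borelS. Qed.
Let borelC A : borel A -> borel (~` A).
Proof. by case: borelS => _ + _ => /[apply]; rewrite setTD. Qed.
Let borelU (F : (set (circle R))^nat) :
  (forall i, borel (F i)) -> borel (\bigcup_i F i).
Proof. by case: borelS => _ _; apply. Qed.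

HB.instance Definition _ := @isMeasurable.Build default_measure_display
  (circle R) borel borel0 borelC borelU.

Lemma measurable_to_circle : measurable_fun [set: R] (@to_circle R).
Proof. by move=> _ S. Qed.

HB.instance Definition _ :=
  isMeasurableFun.Build _ _ R (circle R) (@to_circle R) measurable_to_circle.

End circle_borel.

Section circle_measure.
Context {R : realType}.
Local Open Scope ereal_scope.

(* `[0, 1[ is a fundamental domain of the projection. *)
Definition circle_measure (A : set (circle R)) : \bar R :=
  lebesgue_measure ((@to_circle R @^-1` A) `&` `[0%R, 1%R[).

Let circle_measure0 : circle_measure set0 = 0.
Proof. by rewrite /circle_measure preimage_set0 set0I measure0. Qed.

Let circle_measure_ge0 A : 0 <= circle_measure A.
Proof. exact: measure_ge0. Qed.

Let circle_measure_sigma_additive : semi_sigma_additive circle_measure.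
Proof.
move=> F mF tF mUF; rewrite /circle_measure preimage_bigcup setI_bigcupl.
have mFD i : measurable ((@to_circle R @^-1` F i) `&` `[0%R, 1%R[).
  apply: measurableI; last exact: measurable_itv.
  by rewrite -[X in measurable X]setTI; exact: measurable_to_circle.
apply: measure_sigma_additive => //.
apply/trivIsetP => i j _ _ ij; rewrite setIACA -preimage_setI.
by move/trivIsetP : tF => ->//; rewrite preimage_set0 set0I.
Qed.

HB.instance Definition _ := isMeasure.Build _ _ _ circle_measure
  circle_measure0 circle_measure_ge0 circle_measure_sigma_additive.

Let circle_measureT : circle_measure setT = 1.
Proof.
rewrite /circle_measure preimage_setT setTI.
by rewrite lebesgue_measure_itv/= lte_fin ltr01 oppr0 adde0.
Qed.

HB.instance Definition _ :=
  Measure_isProbability.Build _ _ _ circle_measure circle_measureT.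

End circle_measure.

Definition torus (R : realType) (d : nat) : Type := d.-tuple (circle R).

HB.instance Definition _ (R : realType) (d : nat) := Choice.on (torus R d).
HB.instance Definition _ (R : realType) (d : nat) := Measurable.on (torus R d).

Section torus_group.
Context {R : realType} {d : nat}.
Implicit Types x y z : torus R d.

Definition torus_zero : torus R d := [tuple 0 | i < d].
Definition torus_opp x : torus R d := [tuple - tnth x i | i < d].
Definition torus_add x y : torus R d := [tuple tnth x i + tnth y i | i < d].

Let addA : associative torus_add.
Proof. by move=> x y z; apply: eq_from_tnth => i; rewrite !tnth_mktuple addrA. Qed.
Let addC : commutative torus_add.
Proof. by move=> x y; apply: eq_from_tnth => i; rewrite !tnth_mktuple addrC. Qed.
Let add0 : left_id torus_zero torus_add.
Proof. by move=> x; apply: eq_from_tnth => i; rewrite !tnth_mktuple add0r. Qed.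
Let addN : left_inverse torus_zero torus_opp torus_add.
Proof. by move=> x; apply: eq_from_tnth => i; rewrite !tnth_mktuple addNr. Qed.

HB.instance Definition _ := GRing.isZmodule.Build (torus R d) addA addC add0 addN.

End torus_group.

Section torus_measure.
Variable R : realType.

Definition torus_cons d (p : circle R * torus R d) : torus R d.+1 :=
  [tuple of p.1 :: p.2].

Fact measurable_torus_cons d : measurable_fun setT (@torus_cons d).
Proof. exact: (measurable_cons measurable_fst measurable_snd). Qed.

HB.instance Definition _ d := isMeasurableFun.Build _ _ _ _
  (@torus_cons d) (@measurable_torus_cons d).

Fixpoint torus_measure (d : nat) : probability (torus R d) R :=
  match d with
  | 0 => \d_ ([tuple] : torus R 0)
  | d'.+1 => distribution (circle_measure \x torus_measure d')%E (@torus_cons d')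
  end.

End torus_measure.

(* Lebesgue measure on T^d is the completion of the product measure. As `torus`
   itself carries the Borel sigma-algebra, Lebesgue measurability is
   measurability in the type `torus_lebesgue`, which is convertible to it. *)
Definition torus_lebesgue (R : realType) (d : nat) :=
  caratheodory_type (torus_measure R d)^*%mu.

HB.instance Definition _ (R : realType) (d : nat) :=
  Measurable.on (torus_lebesgue R d).

Definition lebesgue_torus {R : realType} {d : nat} :
    set (torus_lebesgue R d) -> \bar R :=
  @completed_measure_extension _ _ _ (torus_measure R d).

HB.instance Definition _ (R : realType) (d : nat) :=
  Measure.on (@lebesgue_torus R d).

Definition translate {R : realType} {d : nat} (A : set (torus R d))
  (b : torus R d) : set (torus R d) := [set a + b | a in A].

(* Arcs of length at least 1 are the whole circle. *)
Definition closed_arc {R : realType} (I : set (circle R)) : Prop :=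
  exists a b : R, a <= b /\ I = @to_circle R @` `[a, b].

Definition band {R : realType} {d : nat} (d_gt0 : (0 < d)%N)
  (I : set (circle R)) : set (torus R d) :=
  [set x | I (tnth x (Ordinal d_gt0))].

Section random_elements.
Context {dO dT : measure_display} {Omega : measurableType dO}
  {T : measurableType dT} {R : realType} (P : probability Omega R).
Local Open Scope ereal_scope.

Definition mutually_independent {n : nat} (X : 'I_n -> {RV P >-> T}) : Prop :=
  forall (J : {set 'I_n}) (S : 'I_n -> set T), (forall i, measurable (S i)) ->
    P (\bigcap_(i in [set` J]) (X i @^-1` S i)) =
    \prod_(i in J) P (X i @^-1` S i).

End random_elements.

Definition uniform_on {dO : measure_display} {Omega : measurableType dO}
    {R : realType} {d : nat} (P : probability Omega R)
    (B : set (torus R d)) (X : {RV P >-> torus R d}) : Prop :=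
  forall S : set (torus R d), measurable S ->
    (distribution P X S = lebesgue_torus (S `&` B) / lebesgue_torus B)%E.

(* Main.v *)
(* By Fubini and independence, the expected measure of the union is the integral of
   1 - (1 - f / |B|)^n, where f = 1_A * 1_B is the convolution.  Up to affine terms
   the power (1 - s)^n is a positive mixture of the functions (1 - s - v)_+, and the
   integral of f is |A| |B| for all A and B, so it suffices to show that the
   integral of min(f, t) is smallest for parallel bands, for every t >= 0.

   For t < min(|A|, |B|) this follows from the Kneser-Pollard inequality
   int min(f, t) >= t min(1, |A| + |B| - t), whose right-hand side is an upper bound
   for bands.  To prove it, fix B and put c(A) = int min(1_A * 1_B, t) - t |A|.  The
   functional c is invariant under translation and submodular, hence
   2 c(A) >= c(A n (A + y)) + c(A u (A + y)), and by connectedness y can be chosen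
   such that |A n (A + y)| is slightly smaller than |A|: this is a concavity property
   of c as a function of the volume.  So c is at least its value t (|B| - t) at the
   two extremal volumes |A| = t and |A| = 1 + t - |B|. *)
Require Import Defs.
From HB Require Import structures.
From mathcomp Require Import all_boot all_order all_algebra.
From mathcomp Require Import all_classical all_reals all_analysis.
From mathcomp Require Import measurable_realfun.
From mathcomp Require Import ring lra zify.

Set Implicit Arguments.
Unset Strict Implicit.
Unset Printing Implicit Defensive.

Import Order.TTheory GRing.Theory Num.Theory.
Import numFieldNormedType.Exports.

Local Open Scope classical_set_scope.
Local Open Scope ring_scope.

(** * The circle *)

(** At |A| = t the bound 1_A * 1_B <= |A| makes the truncation inactive; at |A| = 1 + t - |B|
    pigeonhole gives 1_A * 1_B >= t everywhere. Both integrals are then explicit, and subtracting t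
    |A| makes the two values of c agree.

    The obstacle is that c is a function of the set and not of its volume, so there is no concave
    function of one variable to work with and no minimiser at hand; moreover the shift y yields
    volumes |A| - s and |A| + s with s known only up to a factor 2. Concavity is therefore used as a
    finite descent with error terms: a small penalty in |A|^2 bounds the number of steps, and step
    size and penalty tend to 0 together at the end. The lower bound on s comes from subadditivity of
    the lost measure in y: a large shift is halved until the loss first falls below the target.

    The mixture formula for powers starts at exponent 2; for n = 1 the integrand is affine in f and
    the two sides are equal.

    Random vectors and Fubini live on the Borel sigma-algebra, so a Lebesgue measurable set is
    replaced by a Borel subset of full measure, uniformly for all of its translates. *)

Section circle_group.
Context {R : realType}.
Implicit Types (u v : R) (x y : circle R) (C : set (circle R)).
Local Open Scope quotient_scope.
Local Notation pr := (@to_circle R).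

Lemma to_circleD u v : pr (u + v) = pr u + pr v.
Proof. exact: (raddfD (\pi_(circle R))). Qed.

Lemma to_circleN u : pr (- u) = - pr u.
Proof. exact: (raddfN (\pi_(circle R))). Qed.

Lemma to_circleB u v : pr (u - v) = pr u - pr v.
Proof. by rewrite to_circleD to_circleN. Qed.

Lemma to_circle_eq u v : (pr u = pr v) <-> (u - v \is a Num.int).
Proof.
split=> [/eqP|uv]; first by rewrite /to_circle eqmodE.
by apply/eqP; rewrite /to_circle eqmodE.
Qed.

Lemma to_circle_int u : u \is a Num.int -> pr u = 0.
Proof.
move=> iu; rewrite (_ : 0 = pr 0); last exact/esym/(raddf0 (\pi_(circle R))).
by apply/to_circle_eq; rewrite subr0.
Qed.

Lemma to_circle_int_shift u v : v \is a Num.int -> pr (u + v) = pr u.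
Proof. by move=> iv; rewrite to_circleD (to_circle_int iv) addr0. Qed.

(** [repr] picks an arbitrary lift; removing its integer part gives the canonical one in [0, 1[, and
    this normalisation is what makes the section measurable. *)
Definition circle_rep x : R := let u := repr x in u - (Num.floor u)%:~R.

Lemma circle_repK x : pr (circle_rep x) = x.
Proof.
rewrite /circle_rep to_circleB (@to_circle_int _%:~R) ?subr0 ?intr_int//.
exact: reprK.
Qed.

Lemma circle_rep_ge0 x : 0 <= circle_rep x.
Proof. by rewrite subr_ge0 floor_le. Qed.

Lemma circle_rep_lt1 x : circle_rep x < 1.
Proof. by rewrite ltrBlDl -intrD1 floorD1_gt. Qed.

Lemma circle_repE u : circle_rep (pr u) = u - (Num.floor u)%:~R.
Proof.
have /to_circle_eq : pr (circle_rep (pr u)) = pr (u - (Num.floor u)%:~R).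
  by rewrite circle_repK to_circleB (@to_circle_int _%:~R) ?subr0 ?intr_int.
move=> /intrP[k fuk].
have f1 := circle_rep_ge0 (pr u); have f2 := circle_rep_lt1 (pr u).
have g1 := floor_le u; have g2 := floorD1_gt u.
rewrite intrD in g2.
have k1 : (k < 1)%R by rewrite -(ltr_int R) -fuk; lra.
have k2 : (-1 < k)%R by rewrite -(ltr_int R) -fuk mulrN1z; lra.
have k0 : k = 0 by lia.
by apply/eqP; rewrite -subr_eq0 fuk k0.
Qed.

Lemma circle_rep_id u : 0 <= u < 1 -> circle_rep (pr u) = u.
Proof.
move=> u01; rewrite circle_repE (_ : Num.floor u = 0) ?subr0//.
by apply/eqP; rewrite floor_eq/= add0r.
Qed.

(** The circle carries the final sigma-algebra, so it is enough to look at the composite with the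
    projection. That is the fractional part, the identity minus a monotone function. *)
Lemma measurable_circle_rep : measurable_fun setT circle_rep.
Proof.
move=> _ Y mY; rewrite setTI /measurable/= /image_set_system/= setTI.
rewrite (_ : _ @^-1` _ = (fun u => u - (Num.floor u)%:~R) @^-1` Y); last first.
  by apply/funext => u /=; rewrite circle_repE.
have m : measurable_fun setT (fun u : R => u - (Num.floor u)%:~R : R).
  apply: measurable_funB => //.
  apply: nondecreasing_measurable => // u v uv.
  by rewrite ler_int le_floor.
by rewrite -[X in measurable X]setTI; apply: m.
Qed.

Lemma measurable_circleP d (T : measurableType d) (f : T -> R) :
  measurable_fun setT f -> measurable_fun setT (pr \o f).
Proof. by move=> mf; apply: measurableT_comp => //; exact: measurable_to_circle. Qed.

(** The domain is a product, not a quotient of the plane, so measurability goes through the section: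
    lift both points, add in the reals, project. *)
Lemma measurable_circle_add :
  measurable_fun setT (fun z : circle R * circle R => z.1 + z.2).
Proof.
rewrite (_ : (fun _ => _) =
    pr \o (fun z : circle R * circle R => circle_rep z.1 + circle_rep z.2)); last first.
  by apply/funext => z /=; rewrite to_circleD !circle_repK.
apply/measurable_circleP/measurable_funD.
- by apply: measurableT_comp => //; exact: measurable_circle_rep.
- by apply: measurableT_comp => //; exact: measurable_circle_rep.
Qed.

Lemma measurable_circle_opp : measurable_fun setT (fun x : circle R => - x).
Proof.
rewrite (_ : (fun _ => _) = pr \o (fun x : circle R => - circle_rep x)); last first.
  by apply/funext => z /=; rewrite to_circleN !circle_repK.
by apply/measurable_circleP/measurableT_comp => //; exact: measurable_circle_rep.
Qed.

Lemma lebesgue_measure_shift (A : set R) v : measurable A ->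
  lebesgue_measure ((fun u => u + v) @^-1` A) = lebesgue_measure A.
Proof.
move=> mA.
have ms : measurable_fun setT (fun u : measurableTypeR R => u + v : measurableTypeR R).
  by apply: measurable_funD.
pose ms_mixin := isMeasurableFun.Build _ _ _ _ _ ms.
pose s : {mfun measurableTypeR R >-> measurableTypeR R} :=
  HB.pack (fun u : measurableTypeR R => u + v : measurableTypeR R) ms_mixin.
apply/esym.
rewrite -[RHS]/(pushforward lebesgue_measure s A).
apply: (@lebesgue_measure_unique R (pushforward lebesgue_measure s)) => // _ [[a b]] _ <-.
transitivity (lebesgue_measure `](a - v), (b - v)]%classic); last first.
  congr (lebesgue_measure _); apply/funext => u /=; apply/propext.
  by rewrite !in_itv/= ltrBlDr lerBrDr.
rewrite !lebesgue_measure_itv/= !lte_fin ltrD2r.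
by case: ifP => // _; rewrite -!EFinB; congr EFin; ring.
Qed.

Lemma measurable_to_circle_preimage C : measurable C -> measurable (pr @^-1` C).
Proof.
by move=> mC; rewrite -[X in measurable X]setTI; exact: measurable_to_circle.
Qed.

Lemma measurable_circle_shift x : measurable_fun setT (fun y : circle R => y + x).
Proof.
apply: (measurableT_comp measurable_circle_add (f := fun z : circle R * circle R => z.1 + z.2) (g := fun y => (y, x))).
exact: measurable_fun_pair.
Qed.

Lemma circle_measure_shift C x : measurable C ->
  circle_measure ((fun y => y + x) @^-1` C) = circle_measure C.
Proof.
move=> mC; rewrite /circle_measure.
set v := circle_rep x; set E := pr @^-1` C.
have mE : measurable E by exact: measurable_to_circle_preimage.
have v0 : 0 <= v by exact: circle_rep_ge0.
have v1 : v < 1 by exact: circle_rep_lt1.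
have splitE (A : set R) (c : R) : measurable A -> 0 <= c -> c <= 1 ->
    lebesgue_measure (A `&` `[0, 1[) =
    (lebesgue_measure (A `&` `[0%R, c[) + lebesgue_measure (A `&` `[c, 1%R[))%E.
  move=> mA c0 c1; rewrite -measureU//; last 3 first.
  - exact: measurableI.
  - exact: measurableI.
  - apply/seteqP; split=> // u [[_ +] [_ +]]; rewrite /= !in_itv/= => /andP[_ uc] /andP[cu _].
    by move: (lt_le_trans uc cu); rewrite ltxx.
  rewrite -setIUr; congr (lebesgue_measure (_ `&` _)).
  apply/seteqP; split=> u /=; rewrite !in_itv/=.
    by move=> /andP[u0 u1]; have [uc|cu] := ltP u c; [left|right]; apply/andP.
  by move=> [/andP[u0 u1]|/andP[u0 u1]]; apply/andP; split=> //; lra.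
have -> : pr @^-1` ((fun y => y + x) @^-1` C) = (fun u => u + v) @^-1` E.
  by apply/seteqP; split => u /=; rewrite /E /= to_circleD circle_repK.
have msh w : measurable_fun setT (fun u : R => u + w) by exact: measurable_funD.
have mshE w (A : set R) : measurable A -> measurable ((fun u : R => u + w) @^-1` A).
  by move=> mA; rewrite -[X in measurable X]setTI; exact: msh.
have mEv := mshE v _ mE.
(* Translation by [v] sends [0, 1 - v[ onto [v, 1[, while [1 - v, 1[ leaves the fundamental domain
   and returns as [0, v[ after subtracting 1. *)
rewrite (splitE _ (1 - v) mEv) ?subr_ge0 ?gerBl ?(ltW v1)//.
rewrite (splitE _ v mE) ?(ltW v1)// addeC; congr (_ + _)%E.
- rewrite -(@lebesgue_measure_shift (E `&` `[0, v[) (v - 1)); last exact: measurableI.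
  congr (lebesgue_measure _); apply/seteqP; split => u /=; rewrite !in_itv/= /E /=.
    move=> [Eu /andP[u1 u2]]; split; last by apply/andP; split; lra.
    by rewrite addrA (@to_circle_int_shift (u + v)) ?rpredN ?rpred1.
  move=> [+ /andP[u1 u2]]; rewrite addrA (@to_circle_int_shift (u + v)) ?rpredN ?rpred1// => Eu.
  by split => //; apply/andP; split; lra.
- rewrite -(@lebesgue_measure_shift (E `&` `[v, 1[) v); last exact: measurableI.
  congr (lebesgue_measure _); apply/seteqP; split => u /=; rewrite !in_itv/= /E /=.
    by move=> [Eu /andP[u1 u2]]; split => //; apply/andP; split; lra.
  by move=> [Eu /andP[u1 u2]]; split => //; apply/andP; split; lra.
Qed.

(** [circle_rep] pushes the circle measure forward to Lebesgue measure on [0, 1[. *)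
Lemma integral_circle (f : circle R -> \bar R) :
  measurable_fun setT f -> (forall x, 0 <= f x)%E ->
  (\int[circle_measure]_x f x = \int[lebesgue_measure]_(u in `[0%R, 1%R[) f (pr u))%E.
Proof.
move=> mf f0.
have mfr : measurable_fun setT (circle_rep : circle R -> measurableTypeR R) by exact: measurable_circle_rep.
pose mfr_mixin := isMeasurableFun.Build _ _ _ _ _ mfr.
pose s : {mfun circle R >-> measurableTypeR R} :=
  HB.pack (circle_rep : circle R -> measurableTypeR R) mfr_mixin.
rewrite (@eq_measure_integral _ _ _ _ (pushforward circle_measure s) lebesgue_measure); last first.
  move=> A mA A01; rewrite /pushforward /circle_measure/=; congr (lebesgue_measure _).
  apply/seteqP; split => u /=.
    move=> Au; have u01 := A01 _ Au; split => //=.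
    by rewrite circle_rep_id//; move: u01; rewrite /= in_itv.
  by rewrite in_itv/= => -[Au u01]; rewrite circle_rep_id in Au.
rewrite ge0_integral_pushforward//=; last first.
  apply: measurable_funTS; apply: measurableT_comp => //; exact: measurable_to_circle.
rewrite (_ : circle_rep @^-1` _ = setT); last first.
  by apply/seteqP; split => // x _ /=; rewrite in_itv/= circle_rep_ge0 circle_rep_lt1.
by apply: eq_integral => x _ /=; rewrite circle_repK.
Qed.

End circle_group.

(** * Haar measure on the torus *)

Section torus_group_facts.
Context {R : realType}.

Lemma tnth_torusD d (x y : torus R d) i : tnth (x + y) i = tnth x i + tnth y i.
Proof. by rewrite tnth_mktuple. Qed.

Lemma tnth_torusN d (x : torus R d) i : tnth (- x) i = - tnth x i.
Proof. by rewrite tnth_mktuple. Qed.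

Lemma tnth_torusB d (x y : torus R d) i : tnth (x - y) i = tnth x i - tnth y i.
Proof. by rewrite tnth_torusD tnth_torusN. Qed.

Lemma measurable_torusP d dT (T : measurableType dT) (f : T -> torus R d) :
  (forall i, measurable_fun setT (fun t => tnth (f t) i)) <-> measurable_fun setT f.
Proof. exact: iff_sym (measurable_fun_tnthP _). Qed.

Lemma measurable_torus_add d dT (T : measurableType dT) (f g : T -> torus R d) :
  measurable_fun setT f -> measurable_fun setT g ->
  measurable_fun setT (fun t => f t + g t).
Proof.
move=> /measurable_torusP mf /measurable_torusP mg; apply/measurable_torusP => i.
rewrite (_ : (fun _ => _) = (fun z : circle R * circle R => z.1 + z.2) \o
  (fun t => (tnth (f t) i, tnth (g t) i))); last first.
  by apply/funext => t /=; rewrite tnth_torusD.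
apply: measurableT_comp; first exact: measurable_circle_add.
exact: measurable_fun_pair.
Qed.

Lemma measurable_torus_opp d dT (T : measurableType dT) (f : T -> torus R d) :
  measurable_fun setT f -> measurable_fun setT (fun t => - f t).
Proof.
move=> /measurable_torusP mf; apply/measurable_torusP => i.
rewrite (_ : (fun _ => _) = (fun z : circle R => - z) \o
  (fun t => tnth (f t) i)); last first.
  by apply/funext => t /=; rewrite tnth_torusN.
by apply: measurableT_comp; first exact: measurable_circle_opp.
Qed.

Lemma measurable_torus_sub d dT (T : measurableType dT) (f g : T -> torus R d) :
  measurable_fun setT f -> measurable_fun setT g ->
  measurable_fun setT (fun t => f t - g t).
Proof. by move=> mf mg; apply: measurable_torus_add => //; exact: measurable_torus_opp. Qed.

Lemma integral_circle_shift (f : circle R -> \bar R) x :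
  measurable_fun setT f -> (forall y, 0 <= f y)%E ->
  (\int[circle_measure]_y f (y + x)%R = \int[circle_measure]_y f y)%E.
Proof.
move=> mf f0; have ms := measurable_circle_shift x.
pose ms_mixin := isMeasurableFun.Build _ _ _ _ _ ms.
pose s : {mfun circle R >-> circle R} := HB.pack (fun y => y + x) ms_mixin.
transitivity (\int[pushforward circle_measure s]_y f y)%E.
  by rewrite ge0_integral_pushforward.
by apply: eq_measure_integral => A mA _; exact: circle_measure_shift.
Qed.

Lemma torus_measureS d (A : set (torus R d.+1)) :
  (torus_measure R d.+1 A =
   \int[circle_measure]_x torus_measure R d [set y | A (torus_cons (x, y))])%E.
Proof.
rewrite /= /distribution /pushforward /product_measure1.
by apply: eq_integral => x _ /=; congr (torus_measure R d _); apply/seteqP; split=> y /=;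
  rewrite /xsection/= inE.
Qed.

Lemma measurable_torus_cons_section d (A : set (torus R d.+1)) x : measurable A ->
  measurable [set y | A (torus_cons (x, y))].
Proof.
move=> mA; rewrite -[X in measurable X]setTI.
have : measurable_fun setT (fun y : torus R d => torus_cons (x, y)).
  exact: (measurableT_comp (@measurable_torus_cons R d) (pair1_measurable x)).
exact.
Qed.

Lemma measurable_fun_torus_section d (A : set (torus R d.+1)) : measurable A ->
  measurable_fun setT (fun x => torus_measure R d [set y | A (torus_cons (x, y))]).
Proof.
move=> mA; have mA' : measurable ((@torus_cons R d) @^-1` A).
  by rewrite -[X in measurable X]setTI; exact: measurable_torus_cons.
have := measurable_fun_xsection (torus_measure R d) mA'.
rewrite /comp; under eq_fun do rewrite /xsection.
congr measurable_fun; apply/funext => x; congr (torus_measure R d _).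
by apply/seteqP; split => y /=; rewrite inE.
Qed.

Lemma measurable_torus_shift d (x : torus R d) (A : set (torus R d)) : measurable A ->
  measurable [set y | A (y + x)].
Proof.
move=> mA; rewrite -[X in measurable X]setTI.
have : measurable_fun setT (fun y : torus R d => y + x).
  exact: measurable_torus_add.
exact.
Qed.

(** Induction on [d], slicing along the first coordinate: invariance of the circle integral handles
    the head, the induction hypothesis handles each slice. *)
Lemma torus_measure_shift d (x : torus R d) (A : set (torus R d)) : measurable A ->
  torus_measure R d [set y | A (y + x)] = torus_measure R d A.
Proof.
elim: d x A => [|d ih] x A mA.
  rewrite /= /dirac; congr (_%:E); rewrite !indicE; congr (_%:R); congr nat_of_bool.
  by apply/idP/idP; rewrite !inE /= [_ + x]tuple0.
rewrite !torus_measureS.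
pose x1 := thead x; pose x2 : torus R d := [tuple of behead x].
rewrite -(@integral_circle_shift (fun x => torus_measure R d [set y | A (torus_cons (x, y))]) x1)//;
  last exact: measurable_fun_torus_section.
apply: eq_integral => y _.
rewrite -[RHS](ih x2); last exact: measurable_torus_cons_section.
congr (torus_measure R d _); apply/seteqP; split=> z /=; congr A.
- apply: eq_from_tnth => i; rewrite tnth_torusD; case: (unliftP ord0 i) => [j|] ->.
    by rewrite !tnthS tnth_torusD tnth_behead; congr (_ + tnth x _);
      apply/val_inj; rewrite /= inordK// ltnS.
  by rewrite !tnth0.
- apply/esym; apply: eq_from_tnth => i; rewrite tnth_torusD; case: (unliftP ord0 i) => [j|] ->.
    by rewrite !tnthS tnth_torusD tnth_behead; congr (_ + tnth x _);
      apply/val_inj; rewrite /= inordK// ltnS.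
  by rewrite !tnth0.
Qed.

(** Every coordinate projection carries the torus measure to the circle measure; bands and cylinders
    are thereby reduced to dimension 1. *)
Lemma torus_measure_tnth d (i : 'I_d) (C : set (circle R)) : measurable C ->
  torus_measure R d [set y | C (tnth y i)] = circle_measure C.
Proof.
elim: d i => [[]//|d ih] i mC.
rewrite torus_measureS; case: (unliftP ord0 i) => [j|] ->.
  transitivity (\int[@circle_measure R]_x (circle_measure C))%E.
    apply: eq_integral => x _; rewrite -(ih j)//.
    by congr (torus_measure R d _); apply/seteqP; split=> y /=; rewrite tnthS.
  rewrite -(fineK (fin_num_measure _ _ mC)).
  by rewrite integral_cst//= probability_setT mule1.
transitivity (\int[@circle_measure R]_x (\1_C x)%:E)%E.
  apply: eq_integral => x _; rewrite indicE; have [xC|xC] := boolP (x \in C).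
    rewrite (_ : [set _ | _] = setT) ?probability_setT//.
    by apply/seteqP; split=> // y _ /=; rewrite tnth0; exact: set_mem.
  rewrite (_ : [set _ | _] = set0) ?measure0//.
  by apply/seteqP; split=> // y /=; rewrite tnth0 => /mem_set; rewrite (negbTE xC).
by rewrite integral_indic// setIT.
Qed.

End torus_group_facts.

(** * Integrability of bounded functions and Tonelli for the sections of a set *)

Section probability_facts.
Context {R : realType}.

Lemma bounded_integrable d (T : measurableType d) (P : probability T R) (f : T -> R) M :
  measurable_fun setT f -> (forall x, `|f x| <= M) -> P.-integrable setT (EFin \o f).
Proof.
move=> mf fM; apply: measurable_bounded_integrable => //.
  by rewrite -ge0_fin_numE// fin_num_measure.
exists M; split; first exact: num_real.
by move=> N MN x _; rewrite /= (le_trans (fM x))// ltW.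
Qed.

Context d1 d2 (T1 : measurableType d1) (T2 : measurableType d2).
Variables (P1 : probability T1 R) (P2 : probability T2 R).
Variables (U : set (T1 * T2)) (mU : measurable U).

Lemma measurable_fun_fst_section : measurable_fun setT (fun x => P2 [set y | U (x, y)]).
Proof.
have := measurable_fun_xsection P2 mU.
congr measurable_fun; apply/funext => x /=; congr (P2 _).
by apply/seteqP; split => y; rewrite /xsection/= inE.
Qed.

Lemma measurable_fst_section x : measurable [set y | U (x, y)].
Proof.
have := measurable_xsection x mU; congr measurable.
by apply/seteqP; split => y; rewrite /xsection/= inE.
Qed.

Lemma measurable_snd_section y : measurable [set x | U (x, y)].
Proof.
have := measurable_ysection y mU; congr measurable.
by apply/seteqP; split => x; rewrite /ysection/= inE.
Qed.

Lemma section_fubini :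
  (\int[P1]_x P2 [set y | U (x, y)] = \int[P2]_y P1 [set x | U (x, y)])%E.
Proof.
transitivity (\int[P1]_x \int[P2]_y (\1_U (x, y))%:E)%E.
  apply: eq_integral => x _.
  transitivity (\int[P2]_y (\1_[set y | U (x, y)] y)%:E)%E.
    by rewrite integral_indic ?setIT//; exact: measurable_fst_section.
  by apply: eq_integral => y _; rewrite !indicE; congr (_%:R%:E); congr nat_of_bool;
    apply/idP/idP; rewrite !inE.
rewrite indic_fubini_tonelli//; apply: eq_integral => y _.
transitivity (\int[P1]_x (\1_[set x | U (x, y)] x)%:E)%E; last first.
  by rewrite integral_indic ?setIT//; exact: measurable_snd_section.
by apply: eq_integral => x _; rewrite !indicE; congr (_%:R%:E); congr nat_of_bool;
    apply/idP/idP; rewrite !inE.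
Qed.

End probability_facts.

(** * The convolution of two indicator functions *)

Section convolution.
Context {R : realType} {d : nat}.
Local Notation T := (torus R d).
Local Notation mu := (torus_measure R d).
Implicit Types (A B : set T) (x y : T) (t : R).

Lemma integral_torus_shift (f : T -> \bar R) x :
  measurable_fun setT f -> (forall y, 0 <= f y)%E ->
  (\int[mu]_y f (y + x)%R = \int[mu]_y f y)%E.
Proof.
move=> mf f0; have ms : measurable_fun setT (fun y : T => y + x).
  exact: measurable_torus_add.
pose ms_mixin := isMeasurableFun.Build _ _ _ _ _ ms.
pose s : {mfun T >-> T} := HB.pack (fun y : T => y + x) ms_mixin.
transitivity (\int[pushforward mu s]_y f y)%E.
  by rewrite ge0_integral_pushforward.
by apply: eq_measure_integral => A mA _; exact: torus_measure_shift.
Qed.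

Definition vol A : R := fine (mu A).

Lemma volE A : measurable A -> (vol A)%:E = mu A.
Proof. by move=> mA; rewrite fineK// fin_num_measure. Qed.

Lemma vol_ge0 A : 0 <= vol A. Proof. exact: fine_ge0. Qed.

Lemma vol_le1 A : measurable A -> vol A <= 1.
Proof. by move=> mA; rewrite -lee_fin volE// probability_le1. Qed.

Lemma vol0 : vol set0 = 0. Proof. by rewrite /vol measure0. Qed.

Lemma volT : vol setT = 1. Proof. by rewrite /vol probability_setT. Qed.

Lemma le_vol A B : measurable A -> measurable B -> A `<=` B -> vol A <= vol B.
Proof. by move=> mA mB AB; rewrite -lee_fin !volE// le_measure// inE. Qed.

Lemma volUI A B : measurable A -> measurable B ->
  vol (A `|` B) + vol (A `&` B) = vol A + vol B.
Proof.
move=> mA mB; have mD : measurable (B `\` A) by exact: measurableD.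
have mI : measurable (A `&` B) by exact: measurableI.
have -> : vol (A `|` B) = vol A + vol (B `\` A).
  apply: EFin_inj; rewrite EFinD !volE//; last exact: measurableU.
  rewrite -measureU//; last by apply/seteqP; split=> // z [Az []].
  congr (mu _); apply/seteqP; split => z /=; last by tauto.
  by move=> [|Bz]; [left|have [|] := pselect (A z); [left|right]].
rewrite -addrA; congr (_ + _); apply: EFin_inj; rewrite EFinD !volE//.
rewrite -measureU//; last by apply/seteqP; split=> // z [[Bz nAz] []].
by congr (mu _); apply/seteqP; split => z /=; [tauto|move=> Bz; have [|] := pselect (A z); tauto].
Qed.

Lemma vol_shift A x : measurable A -> vol [set y | A (y + x)] = vol A.
Proof. by move=> mA; rewrite /vol torus_measure_shift. Qed.

Lemma measurable_sub_preimage A : measurable A ->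
  measurable [set z : T * T | A (z.1 - z.2)].
Proof.
move=> mA; rewrite -[X in measurable X]setTI.
by have : measurable_fun setT (fun z : T * T => z.1 - z.2); [exact: measurable_torus_sub|apply].
Qed.

Lemma measurable_reflect A x : measurable A -> measurable [set y | A (x - y)].
Proof. by move=> /measurable_sub_preimage mA; exact: measurable_fst_section mA x. Qed.

(** Tonelli on the set of pairs with [A (x - y)]: by translation invariance all sections at fixed
    [x] have the measure of -A and all sections at fixed [y] that of A. Both constants are
    integrated over a probability space, so they agree. *)
Lemma torus_measure_reflect A x : measurable A -> mu [set y | A (x - y)] = mu A.
Proof.
move=> mA.
have reflE (z : T) : mu [set y | A (z - y)] = mu [set y | A (- y)].
  rewrite -(@torus_measure_shift _ _ z [set y | A (z - y)]); last exact: measurable_reflect.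
  by congr (mu _); apply/seteqP; split => y /=; rewrite opprD addrCA subrr addr0.
have := section_fubini mu mu (measurable_sub_preimage mA) => /=.
under eq_integral do rewrite reflE.
under [X in _ = X]eq_integral do rewrite torus_measure_shift//.
have cstE (c : \bar R) : c \is a fin_num -> (\int[mu]_x c = c)%E.
  by move=> /fineK <-; rewrite integral_cst//= probability_setT mule1.
rewrite !cstE; last 2 first.
- exact: fin_num_measure.
- apply: fin_num_measure; have := measurable_reflect 0 mA; congr measurable.
  by apply/seteqP; split => y /=; rewrite sub0r.
by rewrite reflE.
Qed.

(** The value of 1_A * 1_B at [x], written as the measure of a set so that its bounds are instances
    of monotonicity and inclusion-exclusion. *)
Definition convol A B x : R := vol (B `&` [set y | A (x - y)]).

Lemma measurable_convol_set A B : measurable A -> measurable B ->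
  measurable [set z : T * T | B z.2 /\ A (z.1 - z.2)].
Proof.
move=> mA mB; apply: measurableI; last exact: measurable_sub_preimage.
by rewrite -[X in measurable X]setTI; exact: measurable_snd.
Qed.

Lemma measurable_convolI A B x : measurable A -> measurable B ->
  measurable (B `&` [set y | A (x - y)]).
Proof. by move=> mA mB; apply: measurableI => //; exact: measurable_reflect. Qed.

Lemma measurable_convol A B : measurable A -> measurable B ->
  measurable_fun setT (convol A B).
Proof.
move=> mA mB; apply: (measurableT_comp (f := @fine R)) => //.
exact: measurable_fun_fst_section (measurable_convol_set mA mB).
Qed.

Lemma convol_ge0 A B x : 0 <= convol A B x. Proof. exact: vol_ge0. Qed.

Lemma convol_ler A B x : measurable A -> measurable B -> convol A B x <= vol B.
Proof. by move=> mA mB; apply: le_vol => //; exact: measurable_convolI. Qed.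

Lemma vol_reflect A x : measurable A -> vol [set y | A (x - y)] = vol A.
Proof. by move=> mA; rewrite /vol torus_measure_reflect. Qed.

Lemma convol_lel A B x : measurable A -> measurable B -> convol A B x <= vol A.
Proof.
move=> mA mB; rewrite -(vol_reflect x mA).
by apply: le_vol => //; [exact: measurable_convolI|exact: measurable_reflect].
Qed.

(** Pigeonhole: two sets of volumes [vol A] and [vol B] in a space of mass 1 overlap at least this
    much. *)
Lemma convol_ge A B x : measurable A -> measurable B -> vol A + vol B - 1 <= convol A B x.
Proof.
move=> mA mB; rewrite -(vol_reflect x mA) addrC /convol.
have mr := measurable_reflect x mA.
have := volUI mB mr; have := vol_le1 (measurableU _ _ mB mr); lra.
Qed.

Lemma integral_convol A B : measurable A -> measurable B ->
  \int[mu]_x convol A B x = vol A * vol B.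
Proof.
move=> mA mB; apply: EFin_inj; rewrite /Rintegral fineK; last first.
  apply: integrable_fin_num => //.
  apply: (@bounded_integrable _ _ _ _ _ 1); first exact: measurable_convol.
  by move=> x; rewrite ger0_norm ?convol_ge0// (le_trans (convol_ler _ _ _))// vol_le1.
rewrite EFinM !volE//.
transitivity (\int[mu]_x mu [set y | B y /\ A (x - y)%R])%E.
  by apply: eq_integral => x _; rewrite volE//; exact: measurable_convolI.
rewrite (section_fubini mu mu (measurable_convol_set mA mB)).
transitivity (\int[mu]_y (mu A * (\1_B y)%:E))%E.
  apply: eq_integral => y _; rewrite indicE.
  have [yB|yB] := boolP (y \in B).
    rewrite mule1 -(torus_measure_shift (- y) mA); congr (mu _).
    by apply/seteqP; split => z /=; [case|move=> ?; split=> //; exact: set_mem].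
  rewrite mule0 (_ : [set _ | _] = set0) ?measure0//.
  by apply/seteqP; split => z //= [/mem_set]; rewrite (negbTE yB).
rewrite -volE// integralZl//; last first.
  apply: (@bounded_integrable _ _ _ _ _ 1) => // y.
  by rewrite indicE; case: (_ \in _); rewrite ?normr0 ?normr1.
by rewrite integral_indic// setIT.
Qed.

End convolution.

(** * Continuity of translations *)

Section asymptotic_invariance.
Context {R : realType} dT (T : measurableType dT) (P : probability T R).
Variable tau : nat -> T -> T.
Hypothesis mtau : forall k, measurable_fun setT (tau k).
Hypothesis tauP : forall k A, measurable A -> P (tau k @^-1` A) = P A.

(** Continuity of translations in measure, phrased for sets: these sets form a sigma-algebra, so the
    property need only be checked on generators. The one-sided difference is enough because each
    [tau k] preserves the measure. *)
Definition asymp_inv : set (set T) := [set A | measurable A /\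
  forall e : R, 0 < e -> exists N, forall k, (N <= k)%N ->
    (P (A `\` tau k @^-1` A) <= e%:E)%E].

Let mpre k A : measurable A -> measurable (tau k @^-1` A).
Proof. by move=> mA; rewrite -[X in measurable X]setTI; exact: mtau. Qed.

Let mdiff k A : measurable A -> measurable (A `\` tau k @^-1` A).
Proof. by move=> mA; apply: measurableD => //; exact: mpre. Qed.

Let asymp_inv0 : asymp_inv set0.
Proof.
split=> // e e0; exists 0%N => k _; rewrite set0D measure0 lee_fin; exact: ltW.
Qed.

(** Complementation reverses the difference of [A] and its preimage; the two differences have equal
    measure since [A] and its preimage do. *)
Let asymp_invC A : asymp_inv A -> asymp_inv (setT `\` A).
Proof.
move=> [mA hA]; rewrite setTD; split; first exact: measurableC.
move=> e /hA[N hN]; exists N => k /hN.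
congr (_ <= _)%E.
rewrite preimage_setC (_ : ~` A `\` _ = tau k @^-1` A `\` A); last first.
  by apply/seteqP; split => z /= [nAz Az]; split => //; exact: contrapT.
have mtA := mpre k mA.
have fP B : measurable B -> (P B < +oo)%E by move=> mB; rewrite ltey_eq fin_num_measure.
by rewrite (measureD mA mtA (fP _ mA)) (measureD mtA mA (fP _ mtA)); congr (_ - _)%E;
  [exact/esym/tauP|rewrite setIC].
Qed.

Let asymp_invU A B : asymp_inv A -> asymp_inv B -> asymp_inv (A `|` B).
Proof.
move=> [mA hA] [mB hB]; split; first exact: measurableU.
move=> e e0; have e20 : 0 < e / 2 by rewrite divr_gt0.
have [N1 h1] := hA _ e20; have [N2 h2] := hB _ e20.
exists (maxn N1 N2) => k; rewrite geq_max => /andP[/h1 {}h1 /h2 {}h2].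
rewrite (splitr e) EFinD; apply: le_trans (leeD h1 h2).
apply: le_trans (measureU2 _ _ _); [|exact: mdiff|exact: mdiff].
apply: le_measure; rewrite ?inE; [exact/mdiff/measurableU|apply: measurableU; exact: mdiff|].
by move=> z /=; tauto.
Qed.

(** A finite subunion [S n] misses at most [e / 2] of the union. A point lost by the union is either
    in this remainder or lost by [S n]. *)
Let asymp_inv_bigcup (F : (set T)^nat) :
  (forall i, asymp_inv (F i)) -> asymp_inv (\bigcup_i F i).
Proof.
move=> hF; have mF i : measurable (F i) by case: (hF i).
have mU : measurable (\bigcup_i F i) by exact: bigcup_measurable.
split=> // e e0; have e20 : 0 < e / 2 by rewrite divr_gt0.
pose S n := \big[setU/set0]_(i < n) F i.
have hS n : asymp_inv (S n).
  by rewrite /S; elim/big_ind: _.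
have mS n : measurable (S n) by case: (hS n).
have SU n : S n `<=` \bigcup_i F i.
  by rewrite /S -bigcup_mkord; apply: bigcup_sub => i _; exact: bigcup_sup.
have cvS : P (S n) @[n --> \oo] --> P (\bigcup_i F i).
  have -> : \bigcup_i F i = \bigcup_n S n.
    apply/seteqP; split => [z [i _ Fiz]|]; last by apply: bigcup_sub => n _; exact: SU.
    by exists i.+1 => //; rewrite /S -bigcup_mkord; exists i => /=.
  apply: (nondecreasing_cvg_mu (F := S)) => //.
    exact: bigcup_measurable.
  move=> m n mn; apply/subsetPset; rewrite /S -!bigcup_mkord.
  by apply: bigcup_sub => i /= im; apply: (bigcup_sup (i := i)) => //=; exact: leq_trans mn.
have [n hn] : exists n, (P ((\bigcup_i F i) `\` S n) <= (e / 2)%:E)%E.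
  have fU : P (\bigcup_i F i) \is a fin_num by exact: fin_num_measure.
  move: cvS; rewrite -(fineK fU) => /fine_cvgP[_ /cvgrPdist_le /(_ _ e20)] [n _ /(_ n (leqnn n))] /=.
  move=> hn; exists n.
  have PD : (P (\bigcup_i F i `\` S n) = P (\bigcup_i F i) - P (S n))%E.
    by rewrite measureD ?(setIidr (SU n))// ltey_eq fU.
  rewrite PD -(fineK fU) -(fineK (fin_num_measure P _ (mS n))) -EFinB lee_fin.
  exact: le_trans (ler_norm _) hn.
have [N hN] := (hS n).2 _ e20.
exists N => k /hN hk; rewrite (splitr e) EFinD; apply: le_trans (leeD hn hk).
have mUS : measurable (\bigcup_i F i `\` S n) by exact: measurableD.
apply: le_trans (measureU2 _ mUS (mdiff k (mS n))).
apply: le_measure; rewrite ?inE; [exact: mdiff|apply: measurableU => //; exact: mdiff|].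
move=> z [Uz nUz]; have [Sz|nSz] := pselect (S n z); [right; split => //|by left].
by move=> Stz; apply: nUz; exact: (SU n).
Qed.

Lemma sigma_algebra_asymp_inv : sigma_algebra setT asymp_inv.
Proof. by split; [exact: asymp_inv0|exact: asymp_invC|exact: asymp_inv_bigcup]. Qed.

End asymptotic_invariance.

Section circle_continuity.
Context {R : realType}.
Variables (v : nat -> R).
Hypothesis v0 : forall e : R, 0 < e -> exists N, forall k, (N <= k)%N -> `|v k| <= e.
Let tau k (x : circle R) := x - to_circle (v k).

Let mtau k : measurable_fun setT (tau k).
Proof. exact: measurable_circle_shift. Qed.

(** Borel sets are generated by open rays, transported to the circle by [circle_rep]. A point lost
    by a ray is close to its endpoint or wraps around 0. *)
Lemma circle_asymp_inv C : measurable C -> asymp_inv (@circle_measure R) tau C.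
Proof.
move=> mC; pose E := @to_circle R @^-1` C.
rewrite (_ : C = circle_rep @^-1` E); last by apply/funext => x; rewrite /E /= circle_repK.
have : measurable E by exact: measurable_to_circle_preimage.
move: E; apply: (@subset_trans _ ((@ocitv R).-sigma.-measurable)) => //.
rewrite RGenOInfty.measurableE.
suff : (@RGenOInfty.G R).-sigma.-measurable `<=`
    image_set_system setT (circle_rep : circle R -> R) (asymp_inv (@circle_measure R) tau).
  by move=> + A mA => /(_ A mA); rewrite /image_set_system /= setTI.
apply: smallest_sub.
  apply: sigma_algebra_image; apply: sigma_algebra_asymp_inv => //.
  by move=> k A mA; exact: circle_measure_shift.
move=> _ [a ->]; rewrite /image_set_system /= setTI; split.
  by rewrite -[X in measurable X]setTI; exact: measurable_circle_rep.
move=> e e0; have [|N hN] := v0 (e := e / 3); first by rewrite divr_gt0.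
exists N => k /hN vk; rewrite /circle_measure.
set w := `|v k| in vk *.
have w0 : 0 <= w by exact: normr_ge0.
have hw : - w <= v k <= w by rewrite -ler_norml.
(* The first two intervals catch the points whose lift leaves [0, 1[ at the left or at the right,
   the third those that cross [a]; each has length at most [e / 3]. *)
pose S : set R := `[0, w] `|` `[1 - w, 1] `|` `[a, a + w].
have mS1 : measurable (`[0, w] `|` `[1 - w, 1] : set R) by exact: measurableU.
have mS : measurable S by exact: measurableU.
apply: (@le_trans _ _ (lebesgue_measure S)).
  apply: le_measure; rewrite ?inE//.
    apply: measurableI => //; apply: measurable_to_circle_preimage.
    apply: measurableD; last first.
      rewrite -[X in measurable X]setTI; apply: mtau => //.
      by rewrite -[X in measurable X]setTI; exact: measurable_circle_rep.
    by rewrite -[X in measurable X]setTI; exact: measurable_circle_rep.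
  move=> u /=; rewrite /S /= !in_itv/= !andbT => -[[+ +] /andP[u0 u1]].
  rewrite circle_rep_id ?u0// => au; rewrite /tau -to_circleB.
  have [h0|h0] := ltP (u - v k) 0; first by move=> _; left; left; lra.
  have [h1|h1] := ltP (u - v k) 1; last by move=> _; left; right; lra.
  by rewrite circle_rep_id ?h0// => /negP; rewrite -leNgt => ?; right; lra.
have lebw (b c : R) : c = b + w -> (lebesgue_measure `[b, c]%classic <= w%:E)%E.
  move=> ->; rewrite lebesgue_measure_itv/= lte_fin; case: ifPn => _.
    by rewrite -EFinB lee_fin; lra.
  by rewrite lee_fin.
apply: (@le_trans _ _ ((w%:E + w%:E) + w%:E)%E); last first.
  by rewrite -!EFinD lee_fin; lra.
apply: le_trans (measureU2 _ _ _) _ => //; apply: leeD; last exact: lebw.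
apply: le_trans (measureU2 _ _ _) _ => //; apply: leeD; apply: lebw; lra.
Qed.

End circle_continuity.

Section torus_continuity.
Context {R : realType} {d : nat}.
Variables (v : nat -> 'I_d -> R) (y : nat -> torus R d).
Hypothesis yv : forall k i, tnth (y k) i = to_circle (v k i).
Hypothesis v0 : forall i (e : R), 0 < e -> exists N, forall k, (N <= k)%N -> `|v k i| <= e.

(** The product sigma-algebra is generated by cylinders over one coordinate, whose loss is that of
    their base in the circle; in dimension 0 there are no cylinders. *)
Lemma torus_asymp_inv A : measurable A ->
  asymp_inv (torus_measure R d) (fun k x => x - y k) A.
Proof.
have mtau k : measurable_fun setT (fun x : torus R d => x - y k).
  exact: measurable_torus_sub.
move: A; apply: smallest_sub.
  apply: sigma_algebra_asymp_inv => // k A mA.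
  exact: torus_measure_shift.
case: d v y yv v0 mtau => [|d'] v' y' yv' v0' mtau; first by rewrite big_ord0.
rewrite -bigcup_mkord_ord; apply: bigcup_sub => j /= jd _ [C mC <-]; rewrite setTI.
set i := inord j; split.
  by rewrite -[X in measurable X]setTI; exact: measurable_tnth.
move=> e e0; have [_ h] := circle_asymp_inv (v0' i) mC.
have [N hN] := h _ e0; exists N => k /hN; apply: le_trans.
have mD : measurable (C `\` (fun x => x - to_circle (v' k i)) @^-1` C).
  apply: measurableD => //; rewrite -[X in measurable X]setTI.
  exact: measurable_circle_shift.
rewrite le_eqVlt; apply/orP; left; apply/eqP.
apply: eq_trans (torus_measure_tnth i mD); congr (torus_measure _ _ _).
by apply/seteqP; split => x /=; rewrite tnth_torusB yv'.
Qed.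

End torus_continuity.

(** * Measure lost under a translation *)

Section window.
Context {R : realType} {d : nat}.
Local Notation T := (torus R d).
Local Notation mu := (torus_measure R d).
Implicit Types (A B : set T) (x y : T).

Definition shift_loss A y : R := vol (A `\` [set x | A (x - y)]).

Lemma measurable_shift_loss A y : measurable A ->
  measurable (A `\` [set x | A (x - y)]).
Proof. by move=> mA; apply: measurableD => //; exact: measurable_torus_shift. Qed.

Lemma shift_lossE A y : measurable A ->
  shift_loss A y = vol A - vol (A `&` [set x | A (x - y)]).
Proof.
move=> mA; have mAy : measurable [set x | A (x - y)] by exact: measurable_torus_shift.
apply/eqP; rewrite eq_sym subr_eq -volUI; last 2 first.
- exact: measurable_shift_loss.
- exact: measurableI.
rewrite (_ : _ `&` (A `&` _) = set0) ?vol0 ?addr0; last first.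
  by apply/seteqP; split => // z [[]] /= _ ? [].
apply/eqP; congr vol; apply/seteqP; split => [z Az|z [[]|[]]//].
by have [?|?] := pselect (A (z - y)); [right|left].
Qed.

(** A point of A outside A + y + z is either outside A + y, or its translate by -y is in A and
    outside A + z. *)
Lemma shift_lossD A y z : measurable A ->
  shift_loss A (y + z) <= shift_loss A y + shift_loss A z.
Proof.
move=> mA; have my := measurable_shift_loss y mA; have mz := measurable_shift_loss z mA.
have mz' := measurable_torus_shift (- y) mz.
rewrite [X in _ <= _ + X](_ : _ = vol [set t | (A `\` [set x | A (x - z)]) (t - y)]); last first.
  by rewrite (vol_shift (- y) mz).
rewrite -volUI//.
apply: (@le_trans _ _ (vol ((A `\` [set x | A (x - y)]) `|`
   [set t | (A `\` [set x | A (x - z)]) (t - y)]))); last by rewrite lerDl vol_ge0.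
apply: le_vol; [exact: measurable_shift_loss|exact: measurableU|].
move=> t [At /=]; rewrite opprD addrA => nAt.
by have [?|?] := pselect (A (t - y)); [right|left].
Qed.

(** Averaging: the measure of the intersection of A and A + x is the convolution of 1_{-A} and 1_A,
    with mean [vol A ^+ 2], so the mean loss is [vol A - vol A ^+ 2]. *)
Lemma exists_shift_loss_gt A (r : R) : measurable A -> r < vol A - vol A ^+ 2 ->
  exists x, r < shift_loss A x.
Proof.
move=> mA rA; apply/not_existsP => h.
have mN : measurable [set z | A (- z)].
  by have := measurable_reflect 0 mA; congr measurable;
    apply/seteqP; split => z /=; rewrite sub0r.
have volN : vol [set z | A (- z)] = vol A.
  by rewrite -(vol_reflect 0 mA); congr vol; apply/seteqP; split => z /=; rewrite sub0r.
have cge x : vol A - r <= convol [set z | A (- z)] A x.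
  have /negP := h x; rewrite -leNgt shift_lossE// => hx.
  rewrite /convol (_ : [set _ | _] = [set z | A (z - x)]); last first.
    by apply/seteqP; split => z /=; rewrite opprB.
  lra.
have : \int[mu]_x (vol A - r) <= \int[mu]_x convol [set z | A (- z)] A x.
  apply: le_Rintegral => //.
  - exact: (@bounded_integrable _ _ _ _ _ `|vol A - r|).
  - apply: (@bounded_integrable _ _ _ _ _ 1); first exact: measurable_convol.
    by move=> x; rewrite ger0_norm ?convol_ge0// (le_trans (convol_ler _ _ _))// vol_le1.
rewrite integral_convol// Rintegral_cst//= volN [fine _]volT mulr1 -expr2.
lra.
Qed.

(* Halving the shift divides the loss by at most 2, and the loss tends to 0 along
   the halvings: this is where connectedness of the torus enters. *)
Lemma exists_shift_loss_window A (r : R) : measurable A -> 0 < r -> r < vol A - vol A ^+ 2 ->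
  exists y, r / 2 <= shift_loss A y <= r.
Proof.
move=> mA r0 rA; have [x rx] := exists_shift_loss_gt mA rA.
(* Halving is done on real lifts: a point of the circle has two halves, and the lift selects those
   that tend to 0. *)
pose v k (i : 'I_d) : R := circle_rep (tnth x i) / 2 ^+ k.
pose y k : T := [tuple to_circle (v k i) | i < d].
have yE k i : tnth (y k) i = to_circle (v k i) by rewrite tnth_mktuple.
have y0 : y 0%N = x.
  by apply: eq_from_tnth => i; rewrite yE /v expr0 divr1 circle_repK.
have yS k : y k = y k.+1 + y k.+1.
  apply: eq_from_tnth => i; rewrite tnth_torusD !yE -to_circleD; congr to_circle.
  by rewrite /v exprS invfM -mulrDr; set q := (2 ^+ k)^-1; lra.
have v0 i (e : R) : 0 < e -> exists N, forall k, (N <= k)%N -> `|v k i| <= e.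
  move=> e0; exists (Num.bound e^-1) => k ek.
  have k0 : (0 : R) < 2 ^+ k by rewrite exprn_gt0.
  rewrite ger0_norm; last by rewrite divr_ge0 ?circle_rep_ge0// ltW.
  rewrite ler_pdivrMr// (le_trans (ltW (circle_rep_lt1 _)))//.
  rewrite -ler_pdivrMl// mulr1 (le_trans (ltW (archi_boundP _)))//; first by rewrite invr_ge0 ltW.
  by rewrite (le_trans (_ : _ <= k%:R))// ?ler_nat// -natrX ler_nat ltnW// ltn_expl.
have [N hN] := (torus_asymp_inv yE v0 mA).2 _ r0.
have ex : exists k, shift_loss A (y k) <= r.
  exists N; rewrite -lee_fin volE; last exact: measurable_shift_loss.
  exact: hN.
(* At the first index with loss at most [r], which is not 0 by the choice of [x], the preceding loss
   exceeds [r], and subadditivity leaves at least half of it. *)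
case: (ex_minnP ex) => [[|k]] hk kmin; first by rewrite y0 leNgt rx in hk.
exists (y k.+1); rewrite hk andbT.
have : r < shift_loss A (y k) by rewrite ltNge; apply/negP => /kmin; rewrite ltnn.
have := shift_lossD (y k.+1) (y k.+1) mA; rewrite -yS; lra.
Qed.

End window.

(** * The Kneser-Pollard inequality *)

Section pollard.
Context {R : realType} {d : nat}.
Local Notation T := (torus R d).
Local Notation mu := (torus_measure R d).
Implicit Types (A B : set T) (x y : T) (t : R).

Definition trunc_convol A B t : R := \int[mu]_x Num.min (convol A B x) t.

Lemma measurable_trunc_convol A B t : measurable A -> measurable B ->
  measurable_fun setT (fun x => Num.min (convol A B x) t).
Proof. by move=> mA mB; apply: measurable_minr => //; exact: measurable_convol. Qed.

Lemma integrable_trunc_convol A B t : measurable A -> measurable B ->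
  mu.-integrable setT (EFin \o (fun x => Num.min (convol A B x) t)).
Proof.
move=> mA mB; apply: (@bounded_integrable _ _ _ _ _ (1 + `|t|)).
  exact: measurable_trunc_convol.
move=> x; have h0 := convol_ge0 A B x.
have h1 : convol A B x <= 1 by rewrite (le_trans (convol_ler _ _ _))// vol_le1.
have := ler_norm t; have := ler_norm (- t); rewrite normrN.
move=> ? ?; rewrite ler_norml; apply/andP; split.
  have ? : - (1 + `|t|) <= convol A B x by lra.
  by rewrite le_min; apply/andP; split; lra.
by rewrite ge_min; apply/orP; left; lra.
Qed.

Lemma integrable_convol A B : measurable A -> measurable B ->
  mu.-integrable setT (EFin \o convol A B).
Proof.
move=> mA mB; apply: (@bounded_integrable _ _ _ _ _ 1); first exact: measurable_convol.
by move=> x; rewrite ger0_norm ?convol_ge0// (le_trans (convol_ler _ _ _))// vol_le1.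
Qed.

Lemma integrable_cst_prob (c : R) : mu.-integrable setT (EFin \o (fun=> c)).
Proof. exact: (@bounded_integrable _ _ _ _ _ `|c|). Qed.

Lemma integral_cst_prob (c : R) : \int[mu]_x c = c.
Proof. by rewrite Rintegral_cst// [fine _]volT mulr1. Qed.

Lemma trunc_convol_ge A B t (f : T -> R) : measurable A -> measurable B ->
  mu.-integrable setT (EFin \o f) -> (forall x, f x <= Num.min (convol A B x) t) ->
  \int[mu]_x f x <= trunc_convol A B t.
Proof. by move=> mA mB If fle; apply: le_Rintegral => //; exact: integrable_trunc_convol. Qed.

Lemma trunc_convol_shift A B t y : measurable A -> measurable B -> 0 <= t ->
  trunc_convol [set x | A (x - y)] B t = trunc_convol A B t.
Proof.
move=> mA mB t0; rewrite /trunc_convol /Rintegral; congr fine.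
rewrite -[RHS](@integral_torus_shift _ _ _ (- y)).
- apply: eq_integral => x _; congr (Num.min (vol _) _)%:E.
  by apply/seteqP; split => z /=; rewrite addrAC.
- by apply/measurable_EFinP; exact: measurable_trunc_convol.
- by move=> x; rewrite lee_fin le_min convol_ge0.
Qed.

Lemma convolUI A A' B x : measurable A -> measurable A' -> measurable B ->
  convol (A `|` A') B x + convol (A `&` A') B x = convol A B x + convol A' B x.
Proof.
move=> mA mA' mB; rewrite /convol -[RHS]volUI; [|exact: measurable_convolI..].
by congr (_ + _); congr vol; apply/seteqP; split => z /=; tauto.
Qed.

(** Pointwise concavity of truncation: the convolutions of union and intersection have the same sum
    as those of [A] and [A'] and enclose them, so truncating their sum costs at least as much. *)
Lemma trunc_convolUI A A' B t : measurable A -> measurable A' -> measurable B ->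
  trunc_convol (A `|` A') B t + trunc_convol (A `&` A') B t <=
  trunc_convol A B t + trunc_convol A' B t.
Proof.
move=> mA mA' mB; have mU := measurableU _ _ mA mA'; have mI := measurableI _ _ mA mA'.
have iA := integrable_trunc_convol t mA mB; have iA' := integrable_trunc_convol t mA' mB.
have iU := integrable_trunc_convol t mU mB; have iI := integrable_trunc_convol t mI mB.
rewrite /trunc_convol -!RintegralD//; apply: le_Rintegral => //.
- exact: integrableD iU iI.
- exact: integrableD iA iA'.
move=> x _; have := convolUI x mA mA' mB.
have le C D : measurable C -> measurable D -> C `<=` D -> convol C B x <= convol D B x.
  move=> mC mD CD; apply: le_vol; [exact: measurable_convolI..|].
  by move=> z /= [Bz /CD].
have := le _ _ mA mU (@subsetUl _ A A'); have := le _ _ mA' mU (@subsetUr _ A A').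
set a := convol A B x; set a' := convol A' B x; set u := convol (A `|` A') B x.
set i := convol (A `&` A') B x => h1 h2 h3.
by rewrite /Num.min; do 4 (case: ltP => ?); lra.
Qed.

Section fixed.
Variables (B : set T) (t : R).
Hypotheses (mB : measurable B) (t0 : 0 < t) (tB : t < vol B).

Let c A := trunc_convol A B t - t * vol A.
Let K := t * (vol B - t).
Let m1 := 1 + t - vol B.

Let K0 : 0 < K. Proof. by rewrite mulr_gt0// subr_gt0. Qed.

Let B1 : vol B <= 1. Proof. exact: vol_le1. Qed.

(** As [convol] is at most [vol A], multiplying it by t / |A| brings it below the truncation without
    cutting. The integral [t * vol B] yields [K] up to t (|A| - t), at most [r]. *)
Let c_left A r : measurable A -> t <= vol A <= t + r -> K - r <= c A.
Proof.
move=> mA /andP[tA Ar]; have A0 : 0 < vol A by exact: lt_le_trans tA.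
have A1 := vol_le1 mA.
have : \int[mu]_x (t / vol A * convol A B x) <= trunc_convol A B t.
  apply: trunc_convol_ge => //.
    have := integrableZl measurableT (t / vol A) (integrable_convol mA mB); exact.
  move=> x; rewrite le_min; apply/andP; split.
    by rewrite ler_piMl ?convol_ge0// ler_pdivrMr// mul1r.
  rewrite mulrAC ler_pdivrMr// ler_pM2l//; exact: convol_lel.
rewrite RintegralZl//; last exact: integrable_convol.
rewrite integral_convol// (_ : _ / _ * _ = t * vol B); last by field; rewrite gt_eqF.
rewrite /c /K => h; nra.
Qed.

(** The pigeonhole bound |A| + |B| - 1 is at most [t] here and so survives truncation. It yields
    exactly [K] at volume [m1], and varies with slope 1 - t in the volume. *)
Let c_right A r : measurable A -> m1 - r <= vol A <= m1 -> K - r <= c A.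
Proof.
rewrite /m1 => mA /andP[Ar Am]; have A1 := vol_le1 mA.
have : \int[mu]_x (Num.min (vol A + vol B - 1) t) <= trunc_convol A B t.
  apply: trunc_convol_ge => //; first exact: integrable_cst_prob.
  by move=> x; rewrite le_min2// convol_ge.
rewrite integral_cst_prob min_l; last lra.
have t1 : 0 <= 1 - t by rewrite subr_ge0 (ltW (lt_le_trans tB B1)).
have t2 : 0 <= vol A - (1 + t - vol B - r) by rewrite subr_ge0.
have r0 : 0 <= r by have := le_trans Ar Am; rewrite gerBl.
have h1 := mulr_ge0 t1 t2; have h2 := mulr_ge0 (ltW t0) r0.
rewrite /c /K; lra.
Qed.

(** The two sets are the intersection and the union of [A] with a translate; the margin [r] at both
    ends keeps their volumes between [t] and [m1]. *)
Let c_step A r : measurable A -> 0 < r -> r < K -> t + r <= vol A -> vol A <= m1 - r ->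
  exists A1 A2 s, [/\ measurable A1, measurable A2,
   vol A1 = vol A - s /\ vol A2 = vol A + s, r / 2 <= s <= r & c A1 + c A2 <= c A + c A].
Proof.
rewrite /m1 /K => mA r0 rK Al Ar.
(* With v = |A|, v - v^2 = K + (v - t)(1 - v) + t (1 - v - (|B| - t)), and the last two terms are
   nonnegative. *)
have rA : r < vol A - vol A ^+ 2.
  have v1 : 0 <= vol A - t by lra.
  have v2 : 0 <= 1 - vol A by rewrite subr_ge0 vol_le1.
  have v3 : 0 <= 1 - vol A - (vol B - t) by lra.
  have h1 := mulr_ge0 v1 v2; have h2 := mulr_ge0 (ltW t0) v3.
  lra.
have [y ry] := exists_shift_loss_window mA r0 rA.
rewrite shift_lossE// in ry.
have mAy : measurable [set x | A (x - y)] by exact: measurable_torus_shift.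
have := volUI mA mAy; rewrite [vol [set x | A (x - y)]](vol_shift (- y) mA).
have := trunc_convolUI t mA mAy mB; rewrite trunc_convol_shift ?(ltW t0)//.
set A1 := A `&` _ in ry *; set A2 := A `|` _ => h1 h2.
exists A1, A2, (vol A - vol A1); split => //; first exact: measurableI.
- exact: measurableU.
- by split; lra.
- rewrite /c; nra.
Qed.

(* The strictly concave term [- eta * vol A ^+ 2] makes one of [A1], [A2] lower
   the functional by a definite amount, so that the descent stops near one of the
   extremal volumes [t] and [m1], where [c_left] and [c_right] apply. *)
Let penalized A r eta : measurable A -> 0 < r -> r < K -> 0 < eta -> eta <= 1 ->
  t <= vol A <= m1 -> K - r - eta <= c A - eta * vol A ^+ 2.
Proof.
move=> mA r0 rK e0 e1 tAm.
have qpos (A' : set T) : measurable A' -> 0 <= vol A' ^+ 2 <= 1.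
  by move=> mA'; have := vol_le1 mA'; have := vol_ge0 A' => ? ?; apply/andP; split; nra.
have d0 : 0 < eta * r ^+ 2 / 4 by rewrite divr_gt0// mulr_gt0// exprn_gt0.
(* [N] bounds the number of remaining descents, each lowering the value by [eta * r ^+ 2 / 4]. The
   level -3 is unreachable: [t * vol A] and the penalty are at most 1 each, so every value is at
   least -2. *)
have [N hN] : exists N, c A - eta * vol A ^+ 2 <= - 3 + N%:R * (eta * r ^+ 2 / 4).
  exists (Num.bound `|(c A - eta * vol A ^+ 2 + 3) / (eta * r ^+ 2 / 4)|).
  rewrite -lerBlDl opprK -ler_pdivrMr//; set q := _ / _.
  exact: le_trans (ler_norm q) (ltW (archi_boundP (normr_ge0 q))).
elim: N A mA tAm hN => [|N ih] A mA tAm hN.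
  exfalso; move: hN; rewrite mul0r addr0 /c.
  have : 0 <= trunc_convol A B t.
    by apply: Rintegral_ge0 => x _; rewrite le_min convol_ge0 ltW.
  have /andP[q0 q1] := qpos _ mA; have A1 := vol_le1 mA; have A0 := vol_ge0 A.
  have t1 : t <= 1 by have := B1; lra.
  have : t * vol A <= 1 by rewrite mulr_ile1// ltW.
  have : eta * vol A ^+ 2 <= 1 by rewrite mulr_ile1// ltW.
  lra.
have := qpos _ mA => qA.
have [Al|Al] := ltP (vol A) (t + r).
  have := @c_left A r mA; rewrite (ltW Al); move: tAm => /andP[-> _] /(_ isT); nra.
have [Ar|Ar] := ltP (m1 - r) (vol A).
  have := @c_right A r mA; rewrite (ltW Ar); move: tAm => /andP[_ ->] /(_ isT); nra.
have [A1 [A2 [s [mA1 mA2 [v1 v2] /andP[rs sr] cc]]]] := c_step mA r0 rK Al Ar.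
(* The squares of |A| - s and |A| + s add up to 2 |A|^2 + 2 s^2 with s >= r / 2; hence one of the
   two sets lies below the value of [A] by the full decrement. *)
have rs2 : r ^+ 2 / 4 <= s ^+ 2 by nra.
have ers := ler_wpM2l (ltW e0) rs2.
have split2 : (c A1 - eta * vol A1 ^+ 2) + (c A2 - eta * vol A2 ^+ 2) <=
    2 * (c A - eta * vol A ^+ 2) - 2 * (eta * r ^+ 2 / 4).
  rewrite v1 v2; lra.
have [h|h] := leP (c A1 - eta * vol A1 ^+ 2)
    (c A - eta * vol A ^+ 2 - eta * r ^+ 2 / 4).
  have : K - r - eta <= c A1 - eta * vol A1 ^+ 2.
    apply: ih => //; first by rewrite v1; apply/andP; split; lra.
    by move: hN; rewrite -[N.+1%:R]natr1 mulrDl mul1r; lra.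
  lra.
have : K - r - eta <= c A2 - eta * vol A2 ^+ 2.
  apply: ih => //; first by rewrite v2; apply/andP; split; lra.
  by move: hN; rewrite -[N.+1%:R]natr1 mulrDl mul1r; lra.
lra.
Qed.

Lemma trunc_convol_ge_mid A : measurable A -> t <= vol A <= 1 + t - vol B ->
  t * (vol A + vol B - t) <= trunc_convol A B t.
Proof.
move=> mA tAm; suff : K <= c A by rewrite /K /c; lra.
apply/ler_addgt0Pr => e e0.
(* [r] is used both as step size and as penalty weight, at a total cost of at most [e]; [K / 2]
   keeps it below [K], and 1 is the cap on the weight. *)
pose r := Num.min (Num.min (e / 2) (K / 2)) 1.
have r0 : 0 < r by rewrite !lt_min ltr01 !divr_gt0.
have r1 : r <= 1 by rewrite ge_min lexx orbT.
have r2 : r <= e / 2 by rewrite !ge_min lexx.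
have r3 : r <= K / 2 by rewrite !ge_min lexx orbT.
have rK : r < K by have := K0; lra.
have := penalized mA r0 rK r0 r1 tAm.
have : 0 <= vol A ^+ 2 by rewrite exprn_ge0// vol_ge0.
nra.
Qed.

End fixed.

(** Truncation does nothing here, since [convol] is bounded by both volumes. *)
Lemma trunc_convol_full A B t : measurable A -> measurable B ->
  vol A <= t \/ vol B <= t -> vol A * vol B <= trunc_convol A B t.
Proof.
move=> mA mB h; rewrite -integral_convol//; apply: trunc_convol_ge => //.
  exact: integrable_convol.
move=> x; rewrite le_min lexx/=; case: h; apply: le_trans.
  exact: convol_lel.
exact: convol_ler.
Qed.

(** Up to volume 1 + t - |B| this is the descent; beyond it pigeonhole puts [convol] above [t]
    everywhere, and the truncated integral is at least [t]. *)
Lemma kneser_pollard A B t : measurable A -> measurable B ->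
  0 <= t < vol A -> t < vol B ->
  t * Num.min 1 (vol A + vol B - t) <= trunc_convol A B t.
Proof.
move=> mA mB /andP[t0 tA] tB.
move: t0; rewrite le_eqVlt => /orP[/eqP <-|t0].
  by rewrite mul0r; apply: Rintegral_ge0 => x _; rewrite le_min convol_ge0/=.
have [Am|mAm] := leP (vol A) (1 + t - vol B).
  apply: le_trans (trunc_convol_ge_mid mB t0 tB mA _); last by rewrite (ltW tA).
  by rewrite ler_pM2l// ge_min lexx orbT.
apply: (@le_trans _ _ t); first by rewrite ler_piMr ?(ltW t0)// ge_min lexx.
rewrite -[leLHS]integral_cst_prob; apply: trunc_convol_ge => //; first exact: integrable_cst_prob.
move=> x; rewrite le_min lexx andbT; have := convol_ge x mA mB; lra.
Qed.

End pollard.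

(** * Bands *)

Section polynomial_integrals.
Context {R : realType}.
Local Notation leb := (@lebesgue_measure R).

Lemma integral_horner_deriv (F : {poly R}) a b : a <= b ->
  (\int[leb]_(x in `[a, b]) (F^`().[x])%:E = (F.[b] - F.[a])%:E)%E.
Proof.
rewrite le_eqVlt => /orP[/eqP <-|ab].
  by rewrite subrr set_itv1 integral_set1.
have cF (p : {poly R}) : continuous (horner p).
  by move=> x; apply: differentiable_continuous; apply/derivable1_diffP/derivable_horner.
rewrite (@continuous_FTC2 _ _ (horner F) _ _ ab) ?EFinB//.
- by apply: continuous_subspaceT; exact: cF.
- split; first by move=> x _; exact: derivable_horner.
  + by apply: cvg_at_right_filter; exact: cF.
  + by apply: cvg_at_left_filter; exact: cF.
- by move=> x _; rewrite -derivE.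
Qed.

Lemma integral_piece_poly (F : {poly R}) (D : set R) (g : R -> R) a b : a <= b ->
  `[a, b] `<=` D -> {in `[a, b], forall u, g u = F^`().[u]} ->
  (forall u, D u -> ~ u \in `[a, b] -> g u = 0) ->
  (\int[leb]_(x in D) (g x)%:E = (F.[b] - F.[a])%:E)%E.
Proof.
move=> ab abD gF g0; rewrite -integral_horner_deriv// integral_mkcond [RHS]integral_mkcond.
apply: eq_integral => u _; rewrite !patchE.
have [uab|uab] := boolP (u \in `[a, b]).
  by rewrite !mem_set//; [rewrite gF|exact: abD].
rewrite [X in _ = if X then _ else _]memNset; last exact/negP.
have [/set_mem uD|//] := boolP (u \in D).
by rewrite g0//; exact/negP.
Qed.

Definition pos_part (x : R) : R := Num.max x 0.

Lemma pos_part_ge0 x : 0 <= pos_part x.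
Proof. by rewrite /pos_part le_max lexx orbT. Qed.

(** For [c < 0] the ramp starts to the left of the interval, and the second term removes the
    triangle over [c, 0]. *)
Lemma integral_pos_part (c : R) : c <= 1 ->
  (\int[leb]_(u in `[0%R, 1%R]) (pos_part (u - c))%:E =
   ((1 - c) ^+ 2 / 2 - pos_part (- c) ^+ 2 / 2)%:E)%E.
Proof.
move=> c1; pose F : {poly R} := 2^-1 *: ('X - c%:P) ^+ 2.
have FE x : F.[x] = (x - c) ^+ 2 / 2.
  by rewrite /F hornerZ horner_exp hornerXsubC mulrC.
have dF x : F^`().[x] = x - c.
  rewrite /F derivZ expr2 derivM derivXsubC mul1r mulr1 hornerZ hornerD hornerXsubC.
  by field.
rewrite (@integral_piece_poly F _ _ (Num.max 0 c) 1).
- rewrite !FE; congr (_ - _ / _)%:E; rewrite /pos_part; congr (_ ^+ 2).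
  by case: (leP 0 c) => ?; case: (leP (- c) 0) => ?; lra.
- by rewrite ge_max c1 ler01.
- move=> u; rewrite /= !in_itv/= ge_max => /andP[/andP[-> _] ->//].
- move=> u; rewrite in_itv/= ge_max dF /pos_part => /andP[/andP[u0 uc] u1].
  by rewrite max_l// subr_ge0.
- move=> u; rewrite /= !in_itv/= ge_max => /andP[-> ->]; rewrite andbT /= => /negP.
  by rewrite -ltNge => uc; rewrite /pos_part max_r// subr_le0 ltW.
Qed.

(** The ramp starting at [c], summed over the lifts [u] and [u + 1] in [0, 2[; two lifts suffice
    because two arcs have total length at most 2. *)
Definition tent_term (c u : R) : R := pos_part (u - c) + pos_part (u + 1 - c).

Lemma measurable_pos_part dT (T : measurableType dT) (D : set T) (f : T -> R) :
  measurable_fun D f ->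
  measurable_fun D (fun u => pos_part (f u)).
Proof. by move=> mf; exact: measurable_maxr. Qed.

Lemma measurable_tent_term (c : R) (D : set R) : measurable_fun D (tent_term c).
Proof.
by apply: measurable_funD; apply: measurable_pos_part;
  apply: measurable_funB => //; apply: measurable_funD.
Qed.

Lemma tent_term_ge0 c u : 0 <= tent_term c u.
Proof. by rewrite addr_ge0// pos_part_ge0. Qed.

Lemma integral_tent_term (c : R) : 0 <= c <= 2 ->
  (\int[leb]_(u in `[0%R, 1%R[) (tent_term c u)%:E = ((2 - c) ^+ 2 / 2)%:E)%E.
Proof.
move=> /andP[c0 c2]; rewrite integral_itv_bndo_bndc; last first.
  by apply/measurable_EFinP; exact: measurable_tent_term.
under eq_integral do rewrite /tent_term EFinD.
have mp (c' : R) : measurable_fun (`[0%R, 1%R]%classic : set R)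
    (fun u : R => (pos_part (u - c'))%:E).
  by apply/measurable_EFinP; apply: measurable_pos_part; exact: measurable_funB.
have E u : u + 1 - c = u - (c - 1) by lra.
under eq_integral do rewrite E.
have mD : measurable (`[0%R, 1%R]%classic : set (measurableTypeR R)) by exact: measurable_itv.
have p0 (c' u : R) : `[0, 1]%classic u -> (0 <= (pos_part (u - c'))%:E)%E.
  by move=> _; rewrite lee_fin pos_part_ge0.
rewrite (ge0_integralD leb mD (p0 _) (mp _) (p0 _) (mp _)).
rewrite (@integral_pos_part (c - 1)); last lra.
have [c1|c1] := leP c 1.
  rewrite integral_pos_part// /pos_part -EFinD (max_r (y := 0 : R)); last lra.
  by rewrite max_l; [congr EFin; field|lra].
rewrite integral0_eq; last first.
  by move=> u; rewrite /= in_itv/= => /andP[u0 u1]; rewrite /pos_part max_r//; lra.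
rewrite add0e /pos_part (max_r (y := 0 : R)); last lra.
by congr EFin; field.
Qed.

Lemma integrable_tent_term (c : R) :
  leb.-integrable `[0%R, 1%R[%classic (EFin \o tent_term c).
Proof.
apply: measurable_bounded_integrable => //.
- have lt1 : (lebesgue_measure (`[0%R, 1%R[%classic : set R) < +oo)%E.
    by rewrite lebesgue_measure_itv/= lte_fin ltr01 -EFinB ltry.
  exact: lt1.
- exact: measurable_tent_term.
- exists (2 * (2 + `|c|)); split; first exact: num_real.
  move=> M hM u; rewrite /= in_itv/= => /andP[u0 u1]; apply: le_trans (ltW hM).
  rewrite ger0_norm ?tent_term_ge0// /tent_term /pos_part.
  have c1 := ler_norm (- c); rewrite normrN in c1.
  have p (x : R) : x <= 2 + `|c| -> Num.max x 0 <= 2 + `|c|.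
    by move=> h; rewrite ge_max h addr_ge0.
  rewrite mulrDl mul1r; apply: lerD; apply: p.
    by rewrite lerD// (le_trans (ltW u1))// ler1n.
  by rewrite lerD// -[2]/(1 + 1) lerD2r ltW.
Qed.

(* The trapezoid [w |-> min t (min w (s - w))] on [0, s] is a second difference of
   positive parts; its values at [u] and [u + 1] are added because it is wrapped
   around the circle. *)
Definition trapezoid_sum s t u : R :=
  tent_term 0 u - tent_term t u - tent_term (s - t) u + tent_term s u.

(** The area of a trapezoid of height [t] with parallel sides s and s - 2t; the ramps cancel beyond
    [s]. *)
Lemma integral_trapezoid_sum (s t : R) : 0 <= t <= 1 -> t + t <= s <= 2 ->
  \int[leb]_(u in `[0, 1[) trapezoid_sum s t u = t * (s - t).
Proof.
move=> /andP[t0 t1] /andP[ts s2].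
have i1 := integrable_tent_term 0; have i2 := integrable_tent_term t.
have i3 := integrable_tent_term (s - t); have i4 := integrable_tent_term s.
have mD : measurable (`[0%R, 1%R[%classic : set (measurableTypeR R)) by exact: measurable_itv.
have iB := integrableB mD i1 i2.
have iBB := integrableB mD iB i3.
rewrite /trapezoid_sum RintegralD//.
rewrite (RintegralB mD iB i3) (RintegralB mD i1 i2).
have E c : 0 <= c <= 2 -> \int[leb]_(u in `[0, 1[) tent_term c u = (2 - c) ^+ 2 / 2.
  by move=> h; rewrite /Rintegral integral_tent_term.
rewrite !E; [by field|apply/andP; split; lra..].
Qed.

(** For w >= 0 and 2t <= s the second difference equals the minimum of t, w and (s - w)_+. *)
Lemma le_trapezoid (s t w x : R) : 0 <= w -> 0 <= t -> t + t <= s -> x <= t -> x <= w ->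
  x <= pos_part (s - w) ->
  x <= pos_part (w - 0) - pos_part (w - t) - pos_part (w - (s - t)) + pos_part (w - s).
Proof.
rewrite /pos_part subr0 => w0 t0 ts xt xw.
rewrite (max_l w0); case: (leP (s - w) 0) => h1; case: (leP (w - t) 0) => h2;
  case: (leP (w - (s - t)) 0) => h3; case: (leP (w - s) 0) => h4; lra.
Qed.

End polynomial_integrals.

(** * Convolution of two arcs *)

Section arcs.
Context {R : realType}.
Implicit Types (a b p q l u : R).
Local Notation pr := (@to_circle R).

Lemma arcE a b : a <= b ->
  pr @` `[a, b] = [set y | circle_rep (y - pr a) <= b - a].
Proof.
move=> ab; apply/seteqP; split => [_ [u + <-]|y /= yb].
  rewrite /= in_itv/= => /andP[au ub]; rewrite -to_circleB circle_repE.
  have : 0 <= Num.floor (u - a) by rewrite floor_ge0 subr_ge0.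
  rewrite -(ler_int R) => ?; lra.
exists (a + circle_rep (y - pr a)); last by rewrite to_circleD circle_repK addrC subrK.
by rewrite /= in_itv/= lerDl circle_rep_ge0/= addrC -lerBrDr.
Qed.

(* [arc p 1] is the whole circle, as [circle_rep] takes values in [0, 1[. *)
Definition arc p l : set (circle R) := [set y | circle_rep (y - pr p) <= l].

Lemma measurable_arc p l : measurable (arc p l).
Proof.
have m : measurable_fun setT (fun y : circle R => circle_rep (y - pr p)).
  by apply: (measurableT_comp measurable_circle_rep); exact: measurable_circle_shift.
have := m measurableT `]-oo, l]%classic (measurable_itv _).
by rewrite setTI; congr measurable; apply/seteqP; split => y /=; rewrite in_itv.
Qed.

Lemma closed_arcE (I : set (circle R)) : closed_arc I -> exists p l, 0 <= l <= 1 /\ I = arc p l.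
Proof.
move=> [a [b [ab ->]]]; exists a, (Num.min (b - a) 1); split.
  by rewrite le_min subr_ge0 ab ler01 ge_min lexx orbT.
rewrite arcE//; apply/seteqP; split => y /=; rewrite /arc /= le_min.
  by move=> ->/=; exact/ltW/circle_rep_lt1.
by move=> /andP[].
Qed.

Lemma arc0E l : arc 0 l = [set y | circle_rep y <= l].
Proof. by apply/seteqP; split => y; rewrite /arc /= (to_circle_int (rpred0 _)) subr0. Qed.

Lemma circle_measure_arc p l : 0 <= l <= 1 -> circle_measure (arc p l) = l%:E.
Proof.
move=> /andP[l0 l1].
have m0 := measurable_arc 0 l.
have -> : circle_measure (arc p l) = circle_measure (arc 0 l).
  by rewrite -(@circle_measure_shift _ (arc 0 l) (- pr p))// arc0E.
have mS : measurable (pr @^-1` arc 0 l `&` `[0, 1[).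
  by apply: measurableI => //; exact: measurable_to_circle_preimage.
(* The lift of the arc lies between [0, l[ and [0, l]; for l = 1 the endpoint falls outside the
   fundamental domain, so neither interval serves for all [l]. *)
rewrite /circle_measure; apply/eqP; rewrite eq_le; apply/andP; split.
  apply: (@le_trans _ _ (lebesgue_measure `[0%R, l]%classic)).
    apply: le_measure; rewrite ?inE// => u.
    by rewrite arc0E /= !in_itv/= => -[+ u01]; rewrite circle_rep_id// => ->; case/andP: u01 => ->.
  by rewrite lebesgue_measure_itv/= lte_fin; case: ltP => h; rewrite -?EFinB lee_fin; lra.
apply: (@le_trans _ _ (lebesgue_measure `[0%R, l[%classic)).
  by rewrite lebesgue_measure_itv/= lte_fin; case: ltP => h; rewrite -?EFinB lee_fin; lra.
apply: le_measure; rewrite ?inE// => u.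
rewrite arc0E /= !in_itv/= => /andP[u0 ul].
have u1 : u < 1 by exact: lt_le_trans l1.
by rewrite circle_rep_id ?u0//; split => //; exact: ltW.
Qed.

Lemma measurable_arc_reflect p a (x : circle R) : measurable [set z | arc p a (x - z)].
Proof.
have m : measurable_fun setT (fun z : circle R => circle_rep (x - z - pr p)).
  apply: (measurableT_comp measurable_circle_rep).
  under eq_fun do rewrite addrAC addrC.
  by apply: (measurableT_comp (measurable_circle_shift (x - pr p))) => //;
    exact: measurable_circle_opp.
have := m measurableT `]-oo, a]%classic (measurable_itv _).
by rewrite setTI; congr measurable; apply/seteqP; split => y /=; rewrite in_itv.
Qed.

(** The set whose measure is the convolution at [x] of the arcs of lengths [a] and [b], both based
    at 0. *)
Definition arc_pair a b (x : circle R) : set (circle R) :=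
  [set z | circle_rep z <= b /\ circle_rep (x - z) <= a].

Lemma measurable_arc_pair a b x : measurable (arc_pair a b x).
Proof.
apply: measurableI; first by have := measurable_arc 0 b; rewrite arc0E.
have := measurable_arc_reflect 0 a x; congr measurable.
by apply/seteqP; split => z; rewrite /arc /= (to_circle_int (rpred0 _)) subr0.
Qed.

Lemma measurable_fun_arc_pair a b :
  measurable_fun setT (fun x => fine (circle_measure (arc_pair a b x))).
Proof.
have mU : measurable [set z : circle R * circle R |
    circle_rep z.2 <= b /\ circle_rep (z.1 - z.2) <= a].
  have le_pre (f : circle R * circle R -> R) (c : R) : measurable_fun setT f ->
      measurable [set z | f z <= c].
    move=> /(_ measurableT `]-oo, c]%classic (measurable_itv _)).
    by rewrite setTI; congr measurable; apply/seteqP; split => y /=; rewrite in_itv.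
  apply: measurableI; apply: le_pre; apply: (measurableT_comp measurable_circle_rep) => //.
  rewrite (_ : (fun _ => _) = (fun z : circle R * circle R => z.1 + z.2) \o
    (fun z => (z.1, - z.2)))//.
  apply: measurableT_comp; first exact: measurable_circle_add.
  by apply: measurable_fun_pair => //; apply: (measurableT_comp measurable_circle_opp).
apply: (measurableT_comp (f := @fine R)) => //.
exact: measurable_fun_fst_section mU.
Qed.

Lemma arc_pair_shift p q a b (x : circle R) :
  circle_measure (arc q b `&` [set z | arc p a (x + pr p + pr q - z)]) =
  circle_measure (arc_pair a b x).
Proof.
have mS := measurable_arc_pair a b x.
rewrite -[RHS](@circle_measure_shift _ _ (- pr q))//; congr circle_measure.
have E z : x + pr p + pr q - z - pr p = x - (z - pr q).
  by rewrite opprB addrA [x + pr p + pr q]addrAC [LHS]addrAC addrK.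
by apply/seteqP; split => z; rewrite /arc /arc_pair /= E.
Qed.

(** Lifting to the line, a summand [w] in [0, b] either has w <= u and complement u - w, or w > u
    and complement u + 1 - w. The two terms bound the lengths of these cases, that is, the
    convolution on the line at [u] and at [u + 1]. *)
Lemma arc_pair_le a b u : 0 <= a <= 1 -> 0 <= b <= 1 -> 0 <= u < 1 ->
  (circle_measure (arc_pair a b (pr u)) <=
    (Num.min u (pos_part (a + b - u)) + pos_part (a + b - (u + 1)))%:E)%E.
Proof.
move=> /andP[a0 a1] /andP[b0 b1] /andP[u0 u1].
rewrite /circle_measure.
pose S : set R := `[Num.max 0 (u - a), Num.min b u] `|` `[u + 1 - a, b].
have mC := measurable_arc_pair a b (pr u).
apply: (@le_trans _ _ (lebesgue_measure S)).
  apply: le_measure; rewrite ?inE.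
  - by apply: measurableI => //; exact: measurable_to_circle_preimage.
  - by apply: measurableU.
  move=> w /=; rewrite /S /= !in_itv/= => -[[+ +] /andP[w0 w1]].
  rewrite circle_rep_id ?w0// => wb; rewrite -to_circleB.
  have [wu|uw] := leP w u.
    rewrite circle_rep_id; last by apply/andP; split; lra.
    move=> h; left; rewrite ge_max le_min w0 wb wu !andbT/=; lra.
  rewrite -(@to_circle_int_shift _ (u - w) 1) ?rpred1// circle_rep_id; last first.
    by apply/andP; split; lra.
  by move=> h; right; apply/andP; split; lra.
have lebi (x y : R) : (lebesgue_measure `[x, y]%classic <= (pos_part (y - x))%:E)%E.
  rewrite lebesgue_measure_itv/= lte_fin; case: ifPn => _; last by rewrite lee_fin pos_part_ge0.
  by rewrite -EFinB lee_fin /pos_part le_max lexx.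
apply: le_trans (measureU2 _ _ _) _ => //; rewrite EFinD; apply: leeD.
  apply: le_trans (lebi _ _) _; rewrite lee_fin /pos_part.
  rewrite le_min; apply/andP; split.
    rewrite ge_max u0 andbT; have : Num.min b u <= u by rewrite ge_min lexx orbT.
    have : 0 <= Num.max 0 (u - a) by rewrite le_max lexx. 
    lra.
  rewrite ge_max [X in _ && X]le_max lexx orbT andbT le_max.
  have h1 : Num.min b u <= b by rewrite ge_min lexx.
  have h2 : u - a <= Num.max 0 (u - a) by rewrite le_max lexx orbT.
  by apply/orP; left; lra.
apply: le_trans (lebi _ _) _; rewrite lee_fin /pos_part.
by rewrite le_eqVlt; apply/orP; left; apply/eqP; congr Num.max; lra.
Qed.

Lemma min_arc_pair_le a b (t : R) u : 0 <= a <= 1 -> 0 <= b <= 1 -> 0 <= u < 1 ->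
  0 <= t -> t <= a -> t <= b ->
  Num.min (fine (circle_measure (arc_pair a b (pr u)))) t <= trapezoid_sum (a + b) t u.
Proof.
move=> ha hb hu t0 ta tb.
have hm : fine (circle_measure (arc_pair a b (pr u))) <=
    Num.min u (pos_part (a + b - u)) + pos_part (a + b - (u + 1)).
  rewrite -lee_fin fineK; first exact: arc_pair_le.
  by apply: fin_num_measure; exact: measurable_arc_pair.
have u0 : 0 <= u by case/andP : hu.
have a1 : a <= 1 by case/andP : ha.
set X := Num.min u _ in hm; set Y := pos_part _ in hm.
have X0 : 0 <= X by rewrite le_min u0 pos_part_ge0.
have Y0 : 0 <= Y by exact: pos_part_ge0.
have w0 : 0 <= u + 1 by lra.
have t2 : t + t <= a + b by lra.
have tX : Num.min X t <= t by rewrite ge_min lexx orbT.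
have tY : Num.min Y t <= t by rewrite ge_min lexx orbT.
have Xu : Num.min X t <= u by rewrite !ge_min lexx.
have Xs : Num.min X t <= pos_part (a + b - u) by rewrite !ge_min lexx orbT.
have Yu : Num.min Y t <= u + 1 by lra.
have Ys : Num.min Y t <= pos_part (a + b - (u + 1)) by rewrite ge_min lexx.
have h1 := le_trapezoid u0 t0 t2 tX Xu Xs.
have h2 := le_trapezoid w0 t0 t2 tY Yu Ys.
(* Truncation at a nonnegative level is subadditive on nonnegative numbers, so the two lifts can be
   truncated separately. *)
have : Num.min (fine (circle_measure (arc_pair a b (pr u)))) t <= Num.min X t + Num.min Y t.
  move: hm; set m := fine _ => hm; rewrite /Num.min; do 3 (case: ltP => ?); lra.
rewrite /trapezoid_sum /tent_term; lra.
Qed.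

Lemma integral_min_arc_pair_le a b (t : R) : 0 <= a <= 1 -> 0 <= b <= 1 ->
  0 <= t -> t <= a -> t <= b ->
  (\int[@circle_measure R]_x (Num.min (fine (circle_measure (arc_pair a b x))) t)%:E <=
   (t * (a + b - t))%:E)%E.
Proof.
move=> ha hb t0 ta tb; have mf := measurable_fun_arc_pair a b.
have mm : measurable_fun setT (fun x => (Num.min (fine (circle_measure (arc_pair a b x))) t)%:E).
  by apply/measurable_EFinP; exact: measurable_minr.
have m0 x : (0 <= (Num.min (fine (circle_measure (arc_pair a b x))) t)%:E)%E.
  by rewrite lee_fin le_min t0 fine_ge0.
have a1 : a <= 1 by case/andP : ha.
have b1 : b <= 1 by case/andP : hb.
rewrite integral_circle//.
rewrite -integral_trapezoid_sum; last 2 first.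
- by apply/andP; split; lra.
- by apply/andP; split; lra.
have mD : measurable (`[0%R, 1%R[%classic : set (measurableTypeR R)) by exact: measurable_itv.
have it : lebesgue_measure.-integrable (`[0%R, 1%R[%classic : set (measurableTypeR R))
    (EFin \o trapezoid_sum (a + b) t).
  have i1 := integrable_tent_term (0 : R); have i2 := integrable_tent_term t.
  have i3 := integrable_tent_term (a + b - t); have i4 := integrable_tent_term (a + b).
  exact: (integrableD mD (integrableB mD (integrableB mD i1 i2) i3) i4).
rewrite /Rintegral fineK; last exact: integrable_fin_num.
apply: ge0_le_integral => //.
- apply: measurable_funTS; apply: measurableT_comp mm _; exact: measurable_to_circle.
- exact: measurable_int it.
- by move=> u; rewrite /= in_itv/= => hu; rewrite lee_fin min_arc_pair_le.
Qed.

End arcs.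

(** * Bands against arbitrary sets *)

Section bands.
Context {R : realType} {d : nat} (d_gt0 : (0 < d)%N).
Local Notation T := (torus R d).
Local Notation mu := (torus_measure R d).
Local Notation i0 := (Ordinal d_gt0).
Implicit Types (A B : set T) (I J : set (circle R)) (t : R).

Lemma measurable_band I : measurable I -> measurable (band d_gt0 I).
Proof. by move=> mI; rewrite -[X in measurable X]setTI; exact: measurable_tnth. Qed.

Lemma torus_measure_band I : measurable I -> mu (band d_gt0 I) = circle_measure I.
Proof. exact: torus_measure_tnth. Qed.

Lemma integral_tnth (f : circle R -> \bar R) :
  measurable_fun setT f -> (forall x, 0 <= f x)%E ->
  (\int[mu]_x f (tnth x i0) = \int[circle_measure]_y f y)%E.
Proof.
move=> mf f0; have ms : measurable_fun setT (fun x : T => tnth x i0) by exact: measurable_tnth.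
pose ms_mixin := isMeasurableFun.Build _ _ _ _ _ ms.
pose s : {mfun T >-> circle R} := HB.pack (fun x : T => tnth x i0) ms_mixin.
transitivity (\int[pushforward mu s]_y f y)%E.
  by rewrite ge0_integral_pushforward.
by apply: eq_measure_integral => A mA _; exact: torus_measure_tnth.
Qed.

Lemma trunc_convol_arcs p q (a b t : R) : 0 <= a <= 1 -> 0 <= b <= 1 ->
  0 <= t -> t <= a -> t <= b ->
  trunc_convol (band d_gt0 (arc p a)) (band d_gt0 (arc q b)) t <= t * (a + b - t).
Proof.
move=> ha hb t0 ta tb; have mf := measurable_fun_arc_pair a b.
pose c := to_circle p + to_circle q.
pose f x := (Num.min (fine (circle_measure (arc_pair a b x))) t)%:E.
have mF : measurable_fun setT f by apply/measurable_EFinP; exact: measurable_minr.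
have f0 x : (0 <= f x)%E by rewrite lee_fin le_min t0 fine_ge0.
have E : (\int[mu]_x (Num.min (convol (band d_gt0 (arc p a)) (band d_gt0 (arc q b)) x) t)%:E =
    \int[circle_measure]_y f y)%E.
  (* The base points [p] and [q] only translate the convolution by [c], and it depends on the first
     coordinate alone. *)
  rewrite -(@integral_circle_shift _ f (- c))// -integral_tnth//; last first.
    by apply: measurableT_comp mF _; exact: measurable_circle_shift.
  apply: eq_integral => x _; rewrite /f; congr (Num.min (fine _) _)%:E.
  rewrite -(arc_pair_shift p q) -(torus_measure_tnth i0); last first.
    by apply: measurableI; [exact: measurable_arc|exact: measurable_arc_reflect].
  have -> : tnth x i0 - c + to_circle p + to_circle q = tnth x i0 by rewrite -addrA subrK.
  by congr (mu _); apply/seteqP; split => z; rewrite /band /= tnth_torusB.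
rewrite /trunc_convol /Rintegral E -lee_fin fineK; last first.
  rewrite ge0_fin_numE ?integral_ge0//; apply: le_lt_trans (ltry (t * (a + b - t))).
  exact: integral_min_arc_pair_le.
exact: integral_min_arc_pair_le.
Qed.

Lemma trunc_convol_bands_le A B I J t : measurable A -> measurable B ->
  closed_arc I -> closed_arc J ->
  mu (band d_gt0 I) = mu A -> mu (band d_gt0 J) = mu B -> 0 <= t ->
  trunc_convol (band d_gt0 I) (band d_gt0 J) t <= trunc_convol A B t.
Proof.
move=> mA mB /closed_arcE[p [a [ha ->]]] /closed_arcE[q [b [hb ->]]].
have ma := measurable_band (measurable_arc p a).
have mb := measurable_band (measurable_arc q b).
rewrite !torus_measure_band; [|exact: measurable_arc..].
rewrite !circle_measure_arc// => aA bB t0.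
have vA : vol A = a by rewrite /vol -aA.
have vB : vol B = b by rewrite /vol -bB.
have va : vol (band d_gt0 (arc p a)) = a.
  by rewrite /vol torus_measure_band ?circle_measure_arc//; exact: measurable_arc.
have vb : vol (band d_gt0 (arc q b)) = b.
  by rewrite /vol torus_measure_band ?circle_measure_arc//; exact: measurable_arc.
have iab := integrable_trunc_convol t ma mb.
have full : vol A <= t \/ vol B <= t ->
    trunc_convol (band d_gt0 (arc p a)) (band d_gt0 (arc q b)) t <= trunc_convol A B t.
  move=> /(trunc_convol_full mA mB); apply: le_trans.
  have -> : vol A * vol B =
      \int[mu]_x convol (band d_gt0 (arc p a)) (band d_gt0 (arc q b)) x.
    by rewrite integral_convol// va vb vA vB.
  apply: le_Rintegral => //.
    exact: integrable_convol.
  by move=> x _; rewrite ge_min lexx.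
have [At|tA] := leP (vol A) t; first by apply: full; left.
have [Bt|tB] := leP (vol B) t; first by apply: full; right.
have tAB : 0 <= t < vol A by rewrite t0.
apply: le_trans (kneser_pollard mA mB tAB tB).
rewrite vA vB in tA tB *.
(* If the minimum is 1, the trivial bound of the truncated integral by [t] already matches;
   otherwise the arcs are computed explicitly. *)
rewrite minEle; case: ifP => _.
  rewrite mulr1 -[leRHS](integral_cst_prob (d := d)); apply: le_Rintegral => //.
    exact: integrable_cst_prob.
  by move=> x _; rewrite ge_min lexx orbT.
by apply: trunc_convol_arcs => //; exact: ltW.
Qed.

End bands.

(** * From truncations to powers *)

Section layers.
Context {R : realType}.
Local Notation leb := (@lebesgue_measure R).

(** The Taylor remainder kernel: its coefficient is the second derivative of [v ^+ m.+2], a power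
    that vanishes to second order at 0, whence no boundary terms. *)
Definition layer m (w v : R) : R := (m.+1 * m.+2)%:R * v ^+ m * pos_part (w - v).

Lemma integral_layer m (w : R) : 0 <= w <= 1 ->
  (\int[leb]_(v in `[0%R, 1%R]) (layer m w v)%:E = (w ^+ m.+2)%:E)%E.
Proof.
move=> /andP[w0 w1].
pose F : {poly R} := (m.+2%:R * w) *: 'X^(m.+1) - m.+1%:R *: 'X^(m.+2).
have FE x : F.[x] = m.+2%:R * w * x ^+ m.+1 - m.+1%:R * x ^+ m.+2.
  by rewrite /F hornerD hornerN !hornerZ !hornerXn.
have dF x : F^`().[x] = (m.+1 * m.+2)%:R * x ^+ m * (w - x).
  rewrite /F derivB !derivZ !derivXn hornerD hornerN !hornerZ !hornerMn !hornerXn /=.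
  rewrite -[_ ^+ m *+ _]mulr_natl -[_ ^+ m.+1 *+ _]mulr_natl natrM exprS.
  by move: (m.+1%:R : R) (m.+2%:R : R) (x ^+ m) => a b y; ring.
rewrite (@integral_piece_poly R F _ _ 0 w)//.
- by rewrite !FE !expr0n /= !exprS -natr1; congr EFin; ring.
- by move=> v /=; rewrite !in_itv/= => /andP[-> vw]/=; exact: le_trans w1.
- move=> v; rewrite in_itv/= dF /layer /pos_part => /andP[v0 vw].
  by rewrite max_l// subr_ge0.
- move=> v; rewrite /= !in_itv/= => /andP[-> v1] /= /negP; rewrite -ltNge => wv.
  by rewrite /layer /pos_part max_r ?mulr0// subr_le0 ltW.
Qed.

Variables (d : measure_display) (T : measurableType d) (P : probability T R).

(* Taylor expansion with integral remainder writes [w ^+ m.+2] as a positive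
   combination of the functions [pos_part (w - v)]. *)
Lemma le_integral_pow m (f g : T -> R) :
  measurable_fun setT f -> measurable_fun setT g ->
  (forall x, 0 <= f x <= 1) -> (forall x, 0 <= g x <= 1) ->
  (forall v, 0 <= v <= 1 ->
    (\int[P]_x (pos_part (f x - v))%:E <= \int[P]_x (pos_part (g x - v))%:E)%E) ->
  (\int[P]_x (f x ^+ m.+2)%:E <= \int[P]_x (g x ^+ m.+2)%:E)%E.
Proof.
move=> mf mg f01 g01 fg.
pose D : set R := `[0, 1]%classic.
(* The indicator extends the layers by zero to the whole line, so that they are nonnegative there
   and Tonelli applies. *)
pose K (h : T -> R) (z : T * R) : \bar R := (\1_D z.2 * layer m (h z.1) z.2)%:E.
have mK (h : T -> R) : measurable_fun setT h -> measurable_fun setT (K h).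
  move=> mh; apply/measurable_EFinP; apply: measurable_funM.
    apply: (measurableT_comp (f := \1_D : R -> R)) => //.
    by apply: measurable_indic; exact: measurable_itv.
  apply: measurable_funM.
    by apply: measurable_funM => //; apply: measurable_funX.
  apply: measurable_pos_part; apply: measurable_funB => //.
  exact: measurableT_comp.
have K0 h z : (0 <= K h z)%E.
  rewrite /K lee_fin indicE; case: (boolP (_ \in D)) => [|_]; last by rewrite mul0r.
  move=> /set_mem; rewrite /D /= in_itv/= => /andP[z0 z1].
  by rewrite mul1r /layer !mulr_ge0 ?exprn_ge0 ?pos_part_ge0.
have KE (h : T -> R) : (forall x, 0 <= h x <= 1) -> measurable_fun setT h ->
    (\int[P]_x (h x ^+ m.+2)%:E = \int[leb]_v \int[P]_x K h (x, v))%E.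
  move=> h01 mh; rewrite -(fubini_tonelli (m1 := P) (m2 := leb) (K h))//; last exact: mK.
  apply: eq_integral => x _; rewrite -integral_layer// integral_mkcond.
  apply: eq_integral => v _; rewrite patchE /K indicE /=.
  by case: ifP => _; rewrite ?mul1r ?mul0r.
rewrite !KE//; apply: ge0_le_integral => //.
- by move=> v _; exact: integral_ge0.
- by apply: (measurable_fun_fubini_tonelli_G (m1 := P) (K f)) => //; exact: mK.
- by apply: (measurable_fun_fubini_tonelli_G (m1 := P) (K g)) => //; exact: mK.
move=> v _; rewrite /K /=.
have [vD|vD] := boolP (v \in D); last first.
  by rewrite !integral0_eq// => x _; rewrite indicE (negbTE vD) mul0r.
have v01 : 0 <= v <= 1 by move/set_mem : vD; rewrite /D /= in_itv.
have v0 : 0 <= v by case/andP : v01.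
have E (h : T -> R) : measurable_fun setT h -> (\int[P]_x (\1_D v * layer m (h x) v)%:E =
    ((m.+1 * m.+2)%:R * v ^+ m)%:E * \int[P]_x (pos_part (h x - v))%:E)%E.
  move=> mh; rewrite -ge0_integralZl_EFin//.
  - by apply: eq_integral => x _; rewrite -EFinM indicE vD mul1r.
  - by move=> x _; rewrite lee_fin pos_part_ge0.
  - by apply/measurable_EFinP; apply: measurable_pos_part; exact: measurable_funB.
  - by rewrite mulr_ge0 ?exprn_ge0.
by rewrite !E//; apply: lee_wpmul2l; [rewrite lee_fin mulr_ge0 ?exprn_ge0|exact: fg].
Qed.

End layers.

(** * Comparison of the miss probabilities *)

Section miss_probability.
Context {R : realType} {d : nat}.
Local Notation T := (torus R d).
Local Notation mu := (torus_measure R d).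
Implicit Types (A B : set T).

(* The probability that [A + b] misses [x], for [b] uniform in [B]. *)
Definition miss A B (x : T) : R := 1 - convol A B x / vol B.

Lemma measurable_miss A B : measurable A -> measurable B ->
  measurable_fun setT (miss A B).
Proof.
move=> mA mB; apply: measurable_funB => //.
by apply: measurable_funM => //; exact: measurable_convol.
Qed.

Lemma miss01 A B x : measurable A -> measurable B -> 0 < vol B -> 0 <= miss A B x <= 1.
Proof.
move=> mA mB B0; rewrite /miss subr_ge0 ler_pdivrMr// mul1r convol_ler//=.
by rewrite gerBl divr_ge0 ?convol_ge0// ltW.
Qed.

(** Pointwise, (1 - v - f/|B|)_+ = (1 - v) - min(f, (1 - v)|B|)/|B|. The minus sign turns lower
    bounds on truncated integrals into upper bounds here. *)
Lemma integral_pos_part_miss A B v : measurable A -> measurable B -> 0 < vol B ->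
  0 <= v <= 1 ->
  (\int[mu]_x (pos_part (miss A B x - v))%:E =
   ((1 - v) - trunc_convol A B ((1 - v) * vol B) / vol B)%:E)%E.
Proof.
move=> mA mB B0 /andP[v0 v1]; set t := (1 - v) * vol B.
have it := integrable_trunc_convol t mA mB.
have E x : pos_part (miss A B x - v) = (1 - v) - (vol B)^-1 * Num.min (convol A B x) t.
  have h : convol A B x = vol B * (convol A B x / vol B) by field; rewrite gt_eqF.
  rewrite /pos_part /miss /t {2}h [(1 - v) * _]mulrC -minr_pMr ?(ltW B0)// mulKf ?gt_eqF//.
  by rewrite /Num.min /Num.max; do 2 (case: ltP => ?); lra.
under eq_integral do rewrite E.
have iB : mu.-integrable setT (EFin \o (fun x => (vol B)^-1 * Num.min (convol A B x) t)).
  by have := integrableZl measurableT (vol B)^-1 it; exact.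
have ic := @integrable_cst_prob R d (1 - v).
transitivity (\int[mu]_x ((1 - v) - (vol B)^-1 * Num.min (convol A B x) t))%:E.
  rewrite /Rintegral fineK//; apply: integrable_fin_num => //.
  exact: (integrableB measurableT ic iB).
by rewrite RintegralB// RintegralZl// integral_cst_prob mulrC.
Qed.

Lemma le_integral_miss n (d_gt0 : (0 < d)%N) A B (I J : set (circle R)) :
  (0 < n)%N -> measurable A -> measurable B -> 0 < vol B ->
  closed_arc I -> closed_arc J ->
  measurable (band d_gt0 I) -> measurable (band d_gt0 J) ->
  mu (band d_gt0 I) = mu A -> mu (band d_gt0 J) = mu B ->
  (\int[mu]_x (miss A B x ^+ n)%:E <=
   \int[mu]_x (miss (band d_gt0 I) (band d_gt0 J) x ^+ n)%:E)%E.
Proof.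
move=> n0 mA mB B0 aI aJ mI mJ eI eJ.
have vI : vol (band d_gt0 I) = vol A by rewrite /vol eI.
have vJ : vol (band d_gt0 J) = vol B by rewrite /vol eJ.
have J0 : 0 < vol (band d_gt0 J) by rewrite vJ.
(* Layers handle exponents from 2 on; for exponent 1 only the integral of [convol] enters, and it
   depends on the volumes alone. *)
case: n n0 => [//|[_|m _]]; last first.
  apply: le_integral_pow; [exact: measurable_miss..| | |].
  - by move=> x; exact: miss01.
  - by move=> x; exact: miss01.
  move=> v v01; rewrite !integral_pos_part_miss// lee_fin vJ.
  rewrite lerD2l lerN2 ler_pM2r ?invr_gt0//.
  apply: trunc_convol_bands_le => //; rewrite mulr_ge0 ?(ltW B0)//.
  by rewrite subr_ge0; case/andP : v01.
have E (C D : set T) : measurable C -> measurable D -> (\int[mu]_x (miss C D x ^+ 1)%:E =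
    (1 - vol C * vol D / vol D)%:E)%E.
  move=> mC mD.
  under eq_integral do rewrite expr1 /miss mulrC.
  have iB : mu.-integrable setT (EFin \o (fun x => (vol D)^-1 * convol C D x)).
    by have := integrableZl measurableT (vol D)^-1 (integrable_convol mC mD); exact.
  have ic := @integrable_cst_prob R d 1.
  transitivity (\int[mu]_x (1 - (vol D)^-1 * convol C D x))%:E.
    rewrite /Rintegral fineK//; apply: integrable_fin_num => //.
    exact: (integrableB measurableT ic iB).
  rewrite RintegralB// RintegralZl//; last exact: integrable_convol.
  by rewrite integral_cst_prob integral_convol// mulrC.
by rewrite !E// vI vJ.
Qed.

End miss_probability.

(** * Expected measure of a union of random translates *)

Section borel_sandwich.
Context {R : realType} dT (T : measurableType dT) (P : probability T R).
Implicit Types X Y A : set T.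
Local Notation "P ^*" := (mu_ext P).

Lemma mu_ext_fin_num X : P^* X \is a fin_num.
Proof.
rewrite ge0_fin_numE ?mu_ext_ge0//; apply: (@le_lt_trans _ _ 1%E); last by rewrite ltry.
by rewrite -(probability_setT P) -measurable_mu_extE//; exact: le_mu_ext.
Qed.

(** For each [k] take the union of a cover with total measure within 1/(k+1) of the outer measure;
    the hull is the intersection of these unions. *)
Lemma exists_measurable_hull X : exists H, [/\ measurable H, X `<=` H & P H = P^* X].
Proof.
have /choice[F hF] (k : nat) : exists F : (set T)^nat, measurable_cover X F /\
    (\sum_(0 <= j <oo) P (F j) <= P^* X + (k.+1%:R^-1)%:E)%E.
  have [|_ [F XF <-] lt] := @lb_ereal_inf_adherent R _ k.+1%:R^-1 _ (mu_ext_fin_num X).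
    by rewrite invr_gt0.
  by exists F; split => //; exact: ltW.
have mF k : measurable (\bigcup_j F k j).
  by apply: bigcup_measurable => j _; case: (hF k) => -[mF _] _; exact: mF.
exists (\bigcap_k \bigcup_j F k j); split.
- by apply: bigcapT_measurable => k; exact: mF.
- by move=> x Xx k _; case: (hF k) => -[_ XF] _; exact: XF.
have mH : measurable (\bigcap_k \bigcup_j F k j) by exact: bigcapT_measurable.
apply/eqP; rewrite eq_le; apply/andP; split; last first.
  rewrite -[leRHS]measurable_mu_extE//; apply: le_mu_ext.
  by move=> x Xx k _; case: (hF k) => -[_ XF] _; exact: XF.
apply/lee_addgt0Pr => e e0.
pose k := Num.bound e^-1.
have ke : k.+1%:R^-1 <= e.
  rewrite -[leRHS]invrK lef_pV2 ?posrE ?invr_gt0//.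
  by rewrite (le_trans (ltW (archi_boundP _)))// ?ler_nat// invr_ge0 ltW.
apply: (@le_trans _ _ (P (\bigcup_j F k j))).
  by apply: le_measure; rewrite ?inE//; exact: bigcap_inf.
case: (hF k) => -[mFk _] hk.
apply: le_trans (generalized_Boole_inequality P mFk (mF k)) _.
by apply: le_trans hk _; rewrite leeD2l// lee_fin.
Qed.

(** [A2] is a hull of [A] and [N] a hull of the part of [A2] outside [A]. Testing the Caratheodory
    condition on [A2] forces [N] to be null, by finiteness, and [A1] is [A2] without [N]. *)
Lemma caratheodory_sandwich A : (P^*)%mu.-cara.-measurable A ->
  exists A1 A2, [/\ measurable A1, measurable A2, A1 `<=` A, A `<=` A2 & P (A2 `\` A1) = 0%E].
Proof.
move=> mA; have [A2 [mA2 AA2 eA2]] := exists_measurable_hull A.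
have [N [mN AN eN]] := exists_measurable_hull (A2 `\` A).
have N0 : P N = 0%E.
  have E : (P^* A2 = P^* (A2 `&` A) + P^* (A2 `&` ~` A))%E by exact: mA A2.
  have E2 : P^* A2 = P A2 by exact: measurable_mu_extE.
  move: E; rewrite (setIidr AA2) E2 eA2 -setDE -eN => /esym/eqP.
  rewrite -[X in (_ == X)%E]adde0.
  rewrite -(fineK (mu_ext_fin_num A)) -(fineK (fin_num_measure P _ mN)) -!EFinD.
  by move=> /eqP[] /addrI ->.
exists (A2 `\` N), A2; split => //.
- exact: measurableD.
- by move=> x [A2x nNx]; apply: contrapT => nAx; apply: nNx; apply: AN.
- apply/eqP; rewrite eq_le measure_ge0 andbT -N0; apply: le_measure; rewrite ?inE//.
    by apply: measurableD => //; exact: measurableD.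
  by move=> x [A2x /not_andP[//|/contrapT]].
Qed.

Lemma mu_ext_sandwich X X1 X2 : measurable X1 -> measurable X2 ->
  X1 `<=` X -> X `<=` X2 -> P (X2 `\` X1) = 0%E -> P^* X = P X1.
Proof.
move=> m1 m2 h1 h2 h0; apply/eqP; rewrite eq_le; apply/andP; split; last first.
  by rewrite -[leLHS]measurable_mu_extE//; exact: le_mu_ext.
apply: (@le_trans _ _ (P X2)).
  by rewrite -[leRHS]measurable_mu_extE//; exact: le_mu_ext.
rewrite -[leRHS]adde0 -h0; apply: le_trans (measureU2 _ m1 _); last exact: measurableD.
apply: le_measure; rewrite ?inE//; first by apply: measurableU => //; exact: measurableD.
by move=> x X2x; have [?|?] := pselect (X1 x); [left|right].
Qed.

End borel_sandwich.

(** * Fubini over the random translates *)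

Section expected_union.
Context {R : realType} {d n : nat}.
Local Notation T := (torus R d).
Local Notation mu := (torus_measure R d).
Implicit Types (A B : set T).

Lemma translateE A (y : T) : translate A y = [set x | A (x - y)].
Proof.
apply/seteqP; split => [_ [a Aa <-]|x Ax] /=; first by rewrite addrK.
by exists (x - y) => //; rewrite subrK.
Qed.

Lemma measurable_translate A (y : T) : measurable A -> measurable (translate A y).
Proof. by move=> mA; rewrite translateE; exact: measurable_torus_shift. Qed.

Lemma measurable_bigcup_ord dT (S : measurableType dT) (F : 'I_n -> set S) :
  (forall i, measurable (F i)) -> measurable (\bigcup_(i in [set: 'I_n]) F i).
Proof.
by move=> mF; apply: fin_bigcup_measurable => //; exact: finite_finset.
Qed.

Lemma null_bigcup_ord (F : 'I_n -> set T) :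
  (forall i, measurable (F i)) -> (forall i, mu (F i) = 0%E) ->
  mu (\bigcup_(i in [set: 'I_n]) F i) = 0%E.
Proof.
move=> mF F0; rewrite (_ : [set: 'I_n] = [set` index_enum 'I_n]); last first.
  by apply/seteqP; split => i // _; rewrite /= mem_index_enum.
rewrite bigcup_seq.
apply: (proj2 (A := measurable (\big[setU/set0]_(i <- index_enum 'I_n) F i))).
elim/big_ind : _ => [|X Y [mX X0] [mY Y0]|i _]; last by split.
  by split; [exact: measurable0|exact: measure0].
by split; [exact: measurableU|rewrite measureU0].
Qed.

(** The error is covered by finitely many translates of one null set. It is null for every [y], not
    just for almost every one, so the integrand is replaced by a Borel version outcome by
    outcome. *)
Lemma lebesgue_torus_translates A A1 A2 (y : 'I_n -> T) :
  measurable A1 -> measurable A2 -> A1 `<=` A -> A `<=` A2 -> mu (A2 `\` A1) = 0%E ->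
  lebesgue_torus (\bigcup_(i in [set: 'I_n]) translate A (y i)) =
  mu (\bigcup_(i in [set: 'I_n]) translate A1 (y i)).
Proof.
move=> m1 m2 h1 h2 h0.
have mono C D : C `<=` D -> \bigcup_(i in [set: 'I_n]) translate C (y i) `<=`
    \bigcup_(i in [set: 'I_n]) translate D (y i).
  by move=> CD x [i _ [a Ca <-]]; exists i => //; exists a => //; exact: CD.
have mt C : measurable C -> measurable (\bigcup_(i in [set: 'I_n]) translate C (y i)).
  by move=> mC; apply: measurable_bigcup_ord => i; exact: measurable_translate.
apply: (mu_ext_sandwich (mt _ m1) (mt _ m2) (mono _ _ h1) (mono _ _ h2)).
have mD : measurable (A2 `\` A1) by exact: measurableD.
have N0 : mu (\bigcup_(i in [set: 'I_n]) translate (A2 `\` A1) (y i)) = 0%E.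
  apply: null_bigcup_ord => i; first exact: measurable_translate.
  by rewrite translateE (torus_measure_shift (- y i) mD).
apply/eqP; rewrite eq_le measure_ge0 andbT -N0; apply: le_measure; rewrite ?inE.
- by apply: measurableD; exact: mt.
- exact: mt.
move=> x [[i _ [a A2a <-]] nx]; exists i => //; exists a => //; split => // A1a.
by apply: nx; exists i => //; exists a.
Qed.

Context dO (Omega : measurableType dO) (P : probability Omega R).
Variables (b : 'I_n -> {RV P >-> T}).

Lemma integral_union_translates A B : measurable A -> measurable B -> 0 < vol B ->
  mutually_independent b ->
  (forall i S, measurable S -> P (b i @^-1` S) = (vol (S `&` B) / vol B)%:E) ->
  (\int[P]_w mu (\bigcup_(i in [set: 'I_n]) translate A (b i w)) =
   \int[mu]_x (1 - miss A B x ^+ n)%:E)%E.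
Proof.
move=> mA mB B0 ind law.
pose U := [set z : Omega * T | exists i, A (z.2 - b i z.1)].
have mU : measurable U.
  rewrite (_ : U = \bigcup_(i in [set: 'I_n]) [set z : Omega * T | A (z.2 - b i z.1)]); last first.
    by apply/seteqP; split => [z [i Az]|z [i _ Az]]; exists i.
  apply: measurable_bigcup_ord => i; rewrite -[X in measurable X]setTI.
  have : measurable_fun setT (fun z : Omega * T => z.2 - b i z.1).
    by apply: measurable_torus_sub => //; apply: measurableT_comp.
  exact.
transitivity (\int[P]_w mu [set x | U (w, x)])%E.
  apply: eq_integral => w _; congr (mu _); apply/seteqP; split => [x [i _]|x [i Ax]].
    by rewrite translateE => Ax; exists i.
  by exists i => //; rewrite translateE.
rewrite (section_fubini P mu mU); apply: eq_integral => x _.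
(* The positions whose translate of [A] misses [x]; [x] is uncovered exactly when all [b i] fall
   into [S]. *)
pose S := ~` [set y | A (x - y)].
have mS : measurable S by apply: measurableC; exact: measurable_reflect.
have PS i : P (b i @^-1` S) = (miss A B x)%:E.
  rewrite law//; congr EFin; rewrite /miss; apply: (mulIf (x := vol B)); first by rewrite gt_eqF.
  rewrite mulfVK ?gt_eqF// mulrBl mul1r mulfVK ?gt_eqF//.
  apply/eqP; rewrite eq_sym subr_eq -volUI; last 2 first.
  - exact: measurableI.
  - exact: measurable_convolI.
  rewrite (_ : _ `&` (B `&` _) = set0) ?vol0 ?addr0; last first.
    by apply/seteqP; split => // y [[nA _] [_ Ay]].
  apply/eqP; congr vol; apply/seteqP; split => [y By|y [[]|[]]//].
  by have [?|?] := pselect (A (x - y)); [right|left].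
have := ind [set: 'I_n]%SET (fun=> S) (fun=> mS).
rewrite (eq_bigr (fun=> (miss A B x)%:E)); last by move=> i _; exact: PS.
rewrite -[X in _ = X]/(\prod_(i in [set: 'I_n]%SET) _)%E => hP.
have -> : [set w | U (w, x)] = ~` (\bigcap_(i in [set` [set: 'I_n]%SET]) b i @^-1` S).
  apply/seteqP; split => w /=.
    by move=> [i Ai] /(_ i); rewrite /= inE => /(_ isT); apply.
  move=> h; apply: contrapT => nU; apply: h => i _ Ai; apply: nU; by exists i.
rewrite probability_setC; last first.
  apply: fin_bigcap_measurable; first exact: finite_finset.
  by move=> i _; rewrite -[X in measurable X]setTI; exact: measurable_funP.
by rewrite hP prodEFin prodr_const cardsT card_ord EFinB.
Qed.

End expected_union.

Section expectation_formula.
Context {R : realType} {d n : nat}.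
Local Notation T := (torus R d).
Local Notation mu := (torus_measure R d).

Lemma lebesgue_torusE (A : set T) : measurable A -> lebesgue_torus A = mu A.
Proof. by move=> mA; exact: measurable_mu_extE. Qed.

(** Each Borel [S] meets [B] and [B1] in sets of equal outer measure, so the uniform law on [B] is
    the one on its Borel core. *)
Lemma uniform_on_law dO (Omega : measurableType dO) (P : probability Omega R)
    (B B1 B2 : set T) (X : {RV P >-> T}) :
  measurable B1 -> measurable B2 -> B1 `<=` B -> B `<=` B2 -> mu (B2 `\` B1) = 0%E ->
  0 < vol B1 -> uniform_on B X ->
  forall S, measurable S -> P (X @^-1` S) = (vol (S `&` B1) / vol B1)%:E.
Proof.
move=> m1 m2 h1 h2 h0 v0 unif S mS.
have -> : P (X @^-1` S) = (lebesgue_torus (S `&` B) / lebesgue_torus B)%E by exact: unif.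
have -> : lebesgue_torus B = (vol B1)%:E.
  by rewrite volE//; exact: (mu_ext_sandwich m1 m2 h1 h2 h0).
have mS1 : measurable (S `&` B1) by exact: measurableI.
have mS2 : measurable (S `&` B2) by exact: measurableI.
have -> : lebesgue_torus (S `&` B) = (vol (S `&` B1))%:E.
  rewrite volE//; apply: (mu_ext_sandwich mS1 mS2); [exact: setIS|exact: setIS|].
  apply/eqP; rewrite eq_le measure_ge0 andbT -h0; apply: le_measure; rewrite ?inE.
  - exact: measurableD.
  - exact: measurableD.
  by move=> x [[Sx B2x] nx]; split => // B1x; apply: nx.
by rewrite inver gt_eqF// -EFinM.
Qed.

Lemma expectation_union_translates dO (Omega : measurableType dO)
    (P : probability Omega R) (b : 'I_n -> {RV P >-> T}) (A A1 A2 B B1 B2 : set T) :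
  measurable A1 -> measurable A2 -> A1 `<=` A -> A `<=` A2 -> mu (A2 `\` A1) = 0%E ->
  measurable B1 -> measurable B2 -> B1 `<=` B -> B `<=` B2 -> mu (B2 `\` B1) = 0%E ->
  0 < vol B1 ->
  mutually_independent b -> (forall i, uniform_on B (b i)) ->
  ('E_P[fun w => fine (lebesgue_torus
     (\bigcup_(i in [set: 'I_n]) translate A (b i w)))] =
   1 - \int[mu]_x (miss A1 B1 x ^+ n)%:E)%E.
Proof.
move=> mA1 mA2 hA1 hA2 hA mB1 mB2 hB1 hB2 hB v0 ind unif.
have law i := uniform_on_law mB1 mB2 hB1 hB2 hB v0 (unif i).
rewrite unlock.
transitivity (\int[P]_w mu (\bigcup_(i in [set: 'I_n]) translate A1 (b i w)))%E.
  apply: eq_integral => w _.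
  rewrite (lebesgue_torus_translates (fun i => b i w) mA1 mA2 hA1 hA2 hA) fineK//.
  apply: fin_num_measure; apply: measurable_bigcup_ord => i; exact: measurable_translate.
rewrite (integral_union_translates mA1 mB1 v0 ind law).
have mm : measurable_fun setT (fun x => miss A1 B1 x ^+ n).
  by apply: measurable_funX; exact: measurable_miss.
have im : mu.-integrable setT (EFin \o (fun x => miss A1 B1 x ^+ n)).
  apply: (@bounded_integrable _ _ _ _ _ 1) => // x.
  have /andP[m0 m1] := miss01 x mA1 mB1 v0.
  by rewrite ger0_norm ?exprn_ge0// exprn_ile1.
have ic := @integrable_cst_prob R d 1.
under eq_integral do rewrite EFinB.
rewrite (integralB measurableT ic im); congr (_ - _)%E.
by rewrite integral_cst//= probability_setT mule1.
Qed.

End expectation_formula.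

Theorem theorem1p3 (R : realType) (d n : nat)
  (d_gt0 : (0 < d)%N) (n_gt0 : (0 < n)%N)
  (A B : set (torus R d))
  (mA : measurable (A : set (torus_lebesgue R d)))
  (mB : measurable (B : set (torus_lebesgue R d)))
  (A_gt0 : (0 < lebesgue_torus A)%E)
  (B_gt0 : (0 < lebesgue_torus B)%E)
  (I J : set (circle R)) (arcI : closed_arc I) (arcJ : closed_arc J)
  (eqA : lebesgue_torus (band d_gt0 I) = lebesgue_torus A)
  (eqB : lebesgue_torus (band d_gt0 J) = lebesgue_torus B)
  (dO : measure_display) (Omega : measurableType dO) (P : probability Omega R)
  (b : 'I_n -> {RV P >-> torus R d})
  (b_indep : mutually_independent b)
  (b_unif : forall i, uniform_on B (b i))
  (dO' : measure_display) (Omega' : measurableType dO')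
  (P' : probability Omega' R)
  (b' : 'I_n -> {RV P' >-> torus R d})
  (b'_indep : mutually_independent b')
  (b'_unif : forall i, uniform_on (band d_gt0 J) (b' i)) :
  ('E_P[fun w => fine (lebesgue_torus
                   (\bigcup_(i in [set: 'I_n]) translate A (b i w)))] >=
   'E_P'[fun w => fine (lebesgue_torus
                   (\bigcup_(i in [set: 'I_n])
                      translate (band d_gt0 I) (b' i w)))])%E.
Proof.
have [A1 [A2 [mA1 mA2 hA1 hA2 hA]]] := caratheodory_sandwich mA.
have [B1 [B2 [mB1 mB2 hB1 hB2 hB]]] := caratheodory_sandwich mB.
have EA : lebesgue_torus A = torus_measure R d A1 by exact: (mu_ext_sandwich mA1 mA2 hA1 hA2 hA).
have EB : lebesgue_torus B = torus_measure R d B1 by exact: (mu_ext_sandwich mB1 mB2 hB1 hB2 hB).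
have measurable_arc_band (K : set (circle R)) : closed_arc K -> measurable (band d_gt0 K).
  by move=> /closed_arcE[p [l [_ ->]]]; apply: measurable_band; exact: measurable_arc.
have mI := measurable_arc_band _ arcI; have mJ := measurable_arc_band _ arcJ.
have D0 (K : set (torus R d)) : torus_measure R d (K `\` K) = 0%E by rewrite setDv measure0.
have eI : torus_measure R d (band d_gt0 I) = torus_measure R d A1.
  by rewrite -lebesgue_torusE// eqA EA.
have eJ : torus_measure R d (band d_gt0 J) = torus_measure R d B1.
  by rewrite -lebesgue_torusE// eqB EB.
have v0 : 0 < vol B1 by rewrite -lte_fin volE// -EB.
have vJ : 0 < vol (band d_gt0 J) by rewrite /vol eJ.
rewrite (expectation_union_translates mA1 mA2 hA1 hA2 hA mB1 mB2 hB1 hB2 hB v0 b_indep b_unif).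
(* A band is Borel and serves as its own inner and outer approximation. *)
rewrite (expectation_union_translates mI mI (@subset_refl _ _) (@subset_refl _ _) (D0 _)
  mJ mJ (@subset_refl _ _) (@subset_refl _ _) (D0 _) vJ b'_indep b'_unif).
by apply: leeB => //; exact: le_integral_miss.
Qed.
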